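(* Let $0<\alpha<1$. There exists an absolute constant $c_\alpha$, depending only on $\alpha$, such that for every martingale $F\in H_{1/(1+\alpha)}(G)$ and every integer $n\geq2$ $$\frac{1}{\log n}\sum_{m=1}^n\frac{\left\Vert\sigma_m^\alpha F\right\Vert_{H_{1/(1+\alpha)}}^{1/(1+\alpha)}}{m}\leq c_\alpha\left\Vert F\right\Vert_{H_{1/(1+\alpha)}}^{1/(1+\alpha)}.$$
   Context: Notation: $\mathbb{N}_+$ is the set of positive integers and $\mathbb{N}=\mathbb{N}_+\cup\{0\}$. The group. $Z_2=\{0,1\}$ is the discrete cyclic group of order 2 with Haar measure giving each singleton measure $1/2$. $G$ is the complete direct product of countably many copies of $Z_2$ (indexed by $\mathbb{N}$), with product topology and normalized (product) Haar measure $\mu$; its elements are sequences $x=(x_0,x_1,\dots)$ with $x_k\in\{0,1\}$. For $x\in G$ put $I_0(x):=G$, $I_n(x):=\{y\in G: y_0=x_0,\dots,y_{n-1}=x_{n-1}\}$. For $0<p<\infty$, $\|f\|_p:=\left(\int_G|f|^p\,d\mu\right)^{1/p}$. Walsh system. Every $n\in\mathbb{N}$ is written uniquely as $n=\sum_{j=0}^\infty n_j2^j$ with $n_j\in\{0,1\}$. Rademacher functions: $r_k(x):=(-1)^{x_k}$. Walsh(-Paley) functions: $w_n(x):=\prod_{k=0}^\infty r_k^{n_k}(x)$. Dyadic martingales and Hardy spaces. Let $\mathcal{F}_n$ be the $\sigma$-algebra generated by $\{I_n(x):x\in G\}$ and $E_n$ the conditional expectation operator relative to $\mathcal{F}_n$.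 A (dyadic) martingale is a sequence $F=(F_n,n\in\mathbb{N})$ of functions $F_n\in L_1(G)$ such that $F_n$ is $\mathcal{F}_n$-measurable for all $n$ and $E_nF_m=F_n$ for all $n\leq m$. Its maximal function is $F^\ast:=\sup_{n\in\mathbb{N}}|F_n|$. For $0<p<\infty$, $H_p(G)$ consists of all martingales $F$ with $\|F\|_{H_p}:=\|F^\ast\|_p<\infty$. A function $f\in L_1(G)$ is identified with the martingale $(E_nf:n\in\mathbb{N})$, so that $\|f\|_{H_p}=\|f^\ast\|_p$ with $f^\ast(x)=\sup_{n\in\mathbb{N}}\frac{1}{\mu(I_n(x))}\left|\int_{I_n(x)}f\,d\mu\right|$; this is the meaning of $\|\sigma_m^\alpha F\|_{H_p}$ below. Fourier coefficients and partial sums. For a martingale $F$, $\widehat{F}(k):=\lim_{n\to\infty}\int_G F_n w_k\,d\mu$ (the limit always exists), and $S_nF:=\sum_{k=0}^{n-1}\widehat{F}(k)w_k$ for $n\in\mathbb{N}_+$, $S_0F:=0$. Cesàro means. For $\beta\neq-1,-2,\dots$ put $A_0^\beta:=1$ and $A_n^\beta:=\frac{(\beta+1)\cdots(\beta+n)}{n!}$ for $n\in\mathbb{N}_+$. The Cesàro $(C,\alpha)$ means are $$\sigma_n^\alpha F:=\frac{1}{A_n^\alpha}\sum_{k=1}^nA_{n-k}^{\alpha-1}S_kF\qquad(n\in\mathbb{N}_+).$$ *)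

(* Defs.v *)
From HB Require Import structures.
From mathcomp Require Import all_boot all_order all_algebra.
From mathcomp Require Import all_classical all_reals all_analysis.
From mathcomp Require Import lra.

Set Implicit Arguments.
Unset Strict Implicit.
Unset Printing Implicit Defensive.

Import Order.TTheory GRing.Theory Num.Theory.
Import numFieldNormedType.Exports.

Local Open Scope classical_set_scope.
Local Open Scope ring_scope.

(* [Z_2] is [bool] with [addb]; the measurable sets are the Borel sets of the
   product topology. *)
Definition dyadic_group : measurableType _ :=
  g_sigma_algebraType (@open cantor_space).

Definition dyadic_add (a x : dyadic_group) : dyadic_group :=
  fun k => a k (+) x k.

Definition cylinder (n : nat) (x : dyadic_group) : set dyadic_group :=
  [set y | forall k, (k < n)%N -> y k = x k].

Definition cylinders (n : nat) : set (set dyadic_group) := range (cylinder n).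

Section Haar.
Context {R : realType}.

(* Normalized Haar measure: translation-invariant probability. It is the product
   of the uniform measures on [bool]; see [haar_cylinder] and [cylinder_haar]. *)
Definition is_haar (mu : probability dyadic_group R) :=
  forall (a : dyadic_group) (A : set dyadic_group), measurable A ->
    mu (dyadic_add a @^-1` A) = mu A.

End Haar.

Section Cylinders.

Lemma measurable_coord k b : measurable [set y : dyadic_group | y k = b].
Proof.
apply: sub_sigma_algebra.
rewrite (_ : [set y : dyadic_group | y k = b] = @proj nat (fun=> bool) k @^-1` [set b])//.
apply: open_comp => [y _|]; first exact: (@proj_continuous nat (fun=> bool) k y).
exact: discrete_open.
Qed.

Lemma cylinder0 x : cylinder 0 x = setT.
Proof. by apply/seteqP; split => y. Qed.

Lemma cylinderS n x :
  cylinder n.+1 x = cylinder n x `&` [set y | y n = x n].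
Proof.
apply/seteqP; split => [y yx|y [yx yn] k].
  by split=> [k kn|]; apply: yx => //; exact: ltnW.
by rewrite ltnS leq_eqVlt => /predU1P[->//|]; exact: yx.
Qed.

Lemma cylinder_refl n x : cylinder n x x. Proof. by []. Qed.

Lemma cylinder_eq n x y : cylinder n x y -> cylinder n x = cylinder n y.
Proof.
move=> yx; apply/seteqP; split=> z zx k kn; first by rewrite zx// yx.
by rewrite zx// yx.
Qed.

Lemma cylinder_sub m n x : (m <= n)%N -> cylinder n x `<=` cylinder m x.
Proof. by move=> mn y yx k km; apply: yx; exact: leq_trans mn. Qed.

Lemma measurable_cylinder n x : measurable (cylinder n x).
Proof.
elim: n => [|n IHn]; first by rewrite cylinder0.
by rewrite cylinderS; apply: measurableI => //; exact: measurable_coord.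
Qed.

Definition dyadic_flip n (x : dyadic_group) : dyadic_group :=
  fun k => if k == n then ~~ x n else x k.

Lemma cylinder_split n x :
  cylinder n x = cylinder n.+1 x `|` cylinder n.+1 (dyadic_flip n x).
Proof.
rewrite !cylinderS -(@cylinder_eq n x (dyadic_flip n x)); last first.
  by move=> k kn; rewrite /dyadic_flip ltn_eqF.
rewrite -setIUr; apply/esym/setIidl => y _ /=.
by rewrite /dyadic_flip eqxx; case: (y n) (x n) => -[]; [left|right|right|left].
Qed.

Lemma cylinder_flipI n x :
  cylinder n.+1 x `&` cylinder n.+1 (dyadic_flip n x) = set0.
Proof.
apply/seteqP; split => // y [/(_ n (ltnSn n)) + /(_ n (ltnSn n))].
by rewrite /dyadic_flip eqxx => ->; case: (x n).
Qed.

Lemma cylinder_ind n (P : set dyadic_group -> Prop) :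
  (forall x, P (cylinder n x)) ->
  (forall k x y, P (cylinder k x) -> P (cylinder k y) ->
    cylinder k x `&` cylinder k y = set0 ->
    P (cylinder k x `|` cylinder k y)) ->
  P setT.
Proof.
move=> Pn PU; rewrite -(cylinder0 point); move: (point : dyadic_group).
have : (0 <= n)%N by [].
move: 0%N => k kn; rewrite -(subKn kn).
elim: (n - k)%N (leq_subr k n) => [_ x|m IHm mn x]; first by rewrite subn0.
rewrite cylinder_split -subSn// subSS.
apply: PU; [exact/IHm/ltnW|exact/IHm/ltnW|].
by rewrite -subSS subSn// cylinder_flipI.
Qed.

Lemma open_sub_cylinder (U : set cantor_space) x : open U -> U x ->
  exists n, cylinder n x `<=` U.
Proof.
move=> oU Ux; apply: contrapT => /forallNP nU.
have {}nU n : exists y, cylinder n x y /\ ~ U y.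
  by have /existsNP[y /not_implyP] := nU n; exists y.
have [y yP] := choice nU.
have yx : (y : nat -> cantor_space) @ \oo --> (x : cantor_space).
  apply/cvg_sup => N V [W] [[Z] oZ <-] ZxN WV.
  apply: (filterS WV); rewrite nbhs_simpl; exists N.+1 => // i /= Ni.
  by rewrite (yP i).1.
have [N _ NU] : nbhs \oo (y @^-1` U) by apply: yx; exact: open_nbhs_nbhs.
by apply: (yP N).2; apply: (NU N) => /=.
Qed.

Definition cylinder_sys : set (set dyadic_group) :=
  [set set0] `|` \bigcup_n cylinders n.

Lemma measurable_cylinder_sys :
  @measurable _ dyadic_group = <<s cylinder_sys >>.
Proof.
pose T := g_sigma_algebraType cylinder_sys.
apply/seteqP; split; last first.
  apply: smallest_sub; first exact: sigma_algebra_measurable.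
  move=> A [->|[n _ [x _ <-]]]; [exact: measurable0|exact: measurable_cylinder].
apply: smallest_sub; first exact: (@sigma_algebra_measurable _ T).
move=> U oU.
pose pt (s : seq bool) : dyadic_group := nth false s.
have UE : U = \bigcup_(s : seq bool)
    (if `[< cylinder (size s) (pt s) `<=` U >]
     then cylinder (size s) (pt s) else set0).
  apply/seteqP; split => [x Ux|x [s _]]; last first.
    by case: asboolP => // + xs; exact.
  have [n nU] := open_sub_cylinder oU Ux.
  have xE : cylinder n (pt (mkseq x n)) = cylinder n x.
    by apply: cylinder_eq => k kn; rewrite /pt nth_mkseq.
  exists (mkseq x n) => //; rewrite size_mkseq xE; case: asboolP => // _.
rewrite UE; apply: (@countable_bigcupT_measurable _ T) => // s.
case: asboolP => _; last exact: (@measurable0 _ T).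
by apply: sub_sigma_algebra; right; exists (size s) => //; exists (pt s).
Qed.

Lemma sigma_cylindersP n A : <<s cylinders n >> A <->
  forall x y, A x -> cylinder n x y -> A y.
Proof.
pose T := g_sigma_algebraType (cylinders n).
split=> [|Asat].
  pose sat := [set B | forall x y, B x -> cylinder n x y -> B y].
  move: A; rewrite -/(<<s cylinders n >> `<=` sat); apply: smallest_sub.
    split => [x y //|A IH x y /= [_ nAx] xy|F IH x y [k _ Fx] xy].
    - split=> // Ay; apply: nAx; apply: IH Ay _ => k kn.
      by rewrite (xy k kn).
    - by exists k => //; exact: IH Fx xy.
  by move=> _ [z _ <-] x y zx xy k kn; rewrite xy// zx.
pose pt (s : seq bool) : dyadic_group := nth false s.
have -> : A = \bigcup_(s : seq bool)
    (if `[< A (pt s) >] then cylinder n (pt s) else set0).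
  apply/seteqP; split => [x Ax|x [s _]]; last first.
    by case: asboolP => // As sx; exact: (Asat _ _ As sx).
  have xs : cylinder n x (pt (mkseq x n)).
    by move=> k kn; rewrite /pt nth_mkseq.
  exists (mkseq x n) => //; case: asboolP => [_|]; last by case; exact: (Asat _ _ Ax xs).
  by rewrite -(cylinder_eq xs).
apply: (@countable_bigcupT_measurable _ T) => // s.
case: asboolP => _; last exact: (@measurable0 _ T).
by apply: sub_sigma_algebra; exists (pt s).
Qed.

Lemma sigma_cylinders_measurable n A : <<s cylinders n >> A -> measurable A.
Proof.
apply: smallest_sub; first exact: sigma_algebra_measurable.
by move=> _ [x _ <-]; exact: measurable_cylinder.
Qed.

Lemma setI_closed_cylinder_sys : setI_closed cylinder_sys.
Proof.
suff cylI m n x y : (m <= n)%N ->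
    cylinder_sys (cylinder m x `&` cylinder n y).
  move=> A B [->|[m _ [x _ <-]]]; first by rewrite set0I; left.
  move=> [->|[n _ [y _ <-]]]; first by rewrite setI0; left.
  by have [mn|/ltnW nm] := leqP m n; [|rewrite setIC]; exact: cylI.
move=> mn; have [xy|xy] := pselect (cylinder m x y).
  rewrite (cylinder_eq xy) setIidr; last exact: cylinder_sub.
  by right; exists n => //; exists y.
left; apply/seteqP; split => // z [zx zy]; apply: xy => k km.
by rewrite -zx// zy//; exact: leq_trans mn.
Qed.

End Cylinders.

Section HaarTheory.
Context {R : realType}.
Implicit Types mu nu : probability dyadic_group R.

Lemma eq_cylinder_measure mu nu :
  (forall n x, mu (cylinder n x) = nu (cylinder n x)) ->
  forall A, measurable A -> mu A = nu A.
Proof.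
move=> munu A mA.
apply: (measure_unique cylinder_sys (fun=> setT)) => //.
- exact: measurable_cylinder_sys.
- exact: setI_closed_cylinder_sys.
- by move=> _; right; exists 0%N => //; exists point => //; rewrite cylinder0.
- by apply/seteqP; split => // x _; exists 0%N.
- move=> _ [->|[n _ [x _ <-]]]; first by rewrite !measure0.
  exact: munu.
- by move=> _; rewrite (@le_lt_trans _ _ 1%E)// ?probability_le1// ltry.
Qed.

Lemma dyadic_addK a x : dyadic_add a (dyadic_add a x) = x.
Proof. by apply/funext => k; rewrite /dyadic_add addKb. Qed.

Lemma preimage_dyadic_add_cylinder a n x :
  dyadic_add a @^-1` cylinder n x = cylinder n (dyadic_add a x).
Proof.
apply/seteqP; split => y yx k kn.
  by rewrite /dyadic_add -(yx k kn) addKb.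
by rewrite /dyadic_add (yx k kn) addKb.
Qed.

Lemma measurable_dyadic_add a : measurable_fun setT (dyadic_add a).
Proof.
apply: (measurability cylinder_sys); first exact: measurable_cylinder_sys.
move=> _ [_ [->|[n _ [x _ <-]]] <-]; first by rewrite preimage_set0 setI0.
by rewrite setTI preimage_dyadic_add_cylinder; exact: measurable_cylinder.
Qed.

Lemma haar_cylinder_eq mu n x y :
  is_haar mu -> mu (cylinder n x) = mu (cylinder n y).
Proof.
move=> hmu; rewrite -(hmu (dyadic_add x y)); last exact: measurable_cylinder.
rewrite preimage_dyadic_add_cylinder; congr (mu (cylinder n _)).
by apply/funext => k; rewrite /dyadic_add addbAC addbb.
Qed.

Lemma haar_cylinder mu n x :
  is_haar mu -> mu (cylinder n x) = (2%:R^-1 ^+ n)%:E.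
Proof.
move=> hmu; elim: n => [|n IHn]; first by rewrite cylinder0 probability_setT.
have : mu (cylinder n x) = (mu (cylinder n.+1 x) +
    mu (cylinder n.+1 (dyadic_flip n x)))%E.
  rewrite cylinder_split measureU//; try exact: measurable_cylinder.
  exact: cylinder_flipI.
rewrite IHn (haar_cylinder_eq _ (dyadic_flip n x) x)//.
have := fin_num_measure mu _ (measurable_cylinder n.+1 x).
case: (mu (cylinder n.+1 x)) => // r _ [] /esym; rewrite -mulr2n => r2.
congr EFin; apply: (@mulfI _ 2%:R) => //.
by rewrite mulr_natl r2 exprS mulrA divff// mul1r.
Qed.

Lemma cylinder_haar mu :
  (forall n x, mu (cylinder n x) = (2%:R^-1 ^+ n)%:E) -> is_haar mu.
Proof.
move=> muc a A mA.
pose h : {mfun dyadic_group >-> dyadic_group} :=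
  HB.pack (dyadic_add a)
    (isMeasurableFun.Build _ _ _ _ _ (measurable_dyadic_add a)).
apply: (@eq_cylinder_measure (distribution mu h) mu) => // n x.
rewrite [LHS](_ : _ = mu (dyadic_add a @^-1` cylinder n x))//.
by rewrite preimage_dyadic_add_cylinder !muc.
Qed.

(* Existence: the image of the uniform probability on [0, 1] under the binary
   expansion [digits]; [T n r] is the integer part of [2 ^ n * r]. *)
Let T (n : nat) (r : R) : nat := Num.truncn (2 ^+ n * r).

Let digits (r : R) : dyadic_group := fun k => odd (T k.+1 r).

Let num (x : dyadic_group) := fix num n :=
  if n is m.+1 then (x m + (num m).*2)%N else 0%N.

Let TS n r : 0 <= r -> T n r = (T n.+1 r)./2.
Proof.
move=> r0; have r0' k : 0 <= 2 ^+ k * r by rewrite mulr_ge0// exprn_ge0.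
apply/eqP; rewrite /T truncn_eq// !exprS -mulrA.
set t := Num.truncn _; have := truncn_itv (r0' n.+1).
rewrite exprS -mulrA -/t => /andP[t1 t2]; clearbody t.
have tE : t%:R = (odd t)%:R + 2 * (t./2)%:R :> R.
  by rewrite -{1}(odd_double_half t) natrD -mul2n natrM.
have := leq_b1 (odd t); rewrite -(ler_nat R) => ot.
have ot0 : 0 <= (odd t)%:R :> R by [].
rewrite -(@natr1 R t) tE in t2; rewrite tE in t1; rewrite -(@natr1 R t./2).
by apply/andP; split; lra.
Qed.

Let digitsE n x r : 0 <= r < 1 ->
  (digits @^-1` cylinder n x) r <-> T n r = num x n.
Proof.
move=> /andP[r0 r1]; rewrite /preimage/=.
elim: n => [|n IHn].
  rewrite cylinder0; split=> // _; rewrite /T expr0 mul1r.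
  by apply/eqP; rewrite truncn_eq// r0.
rewrite cylinderS; split=> [[/IHn + /= nx]|Tx].
  by rewrite (TS _ r0) -nx/= => <-; rewrite odd_double_half.
split; first by apply/IHn; rewrite (TS _ r0) Tx/= half_bit_double.
by rewrite /digits/= Tx/= oddD odd_double addbF oddb.
Qed.

Let num_lt n x : (num x n < 2 ^ n)%N.
Proof.
elim: n => //= n IHn; rewrite expnS mul2n.
apply: (@leq_trans (num x n).+1.*2); last by rewrite leq_double.
by rewrite doubleS ltnS -[leqRHS]add1n leq_add2r leq_b1.
Qed.

Let measurable_digits : measurable_fun [set: measurableTypeR R] digits.
Proof.
have mT k j : measurable ([set r | T k r = j] : set (measurableTypeR R)).
  have mle i : measurable ([set r | (T k r <= i)%N] : set (measurableTypeR R)).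
    rewrite (_ : [set r | _] = `]-oo, (i.+1%:R / 2 ^+ k)[%classic).
      exact: measurable_itv.
    apply/seteqP; split => r; rewrite /= in_itv/= /T truncn_le_nat.
      by rewrite ltr_pdivlMr ?exprn_gt0// mulrC.
    by rewrite ltr_pdivlMr ?exprn_gt0// mulrC.
  case: j => [|j].
    rewrite (_ : [set r | _] = [set r | (T k r <= 0)%N])//.
    by apply/seteqP; split => r /=; [move=> ->|rewrite leqn0 => /eqP].
  rewrite (_ : [set r | _] = [set r | (T k r <= j.+1)%N] `\` [set r | (T k r <= j)%N]).
    exact: measurableD.
  apply/seteqP; split => r /=; first by move=> ->; rewrite ltnn.
  by case=> Tj /negP; rewrite -ltnNge => jT; apply/eqP; rewrite eqn_leq Tj.
have mc k b : measurable ([set r | digits r k = b] : set (measurableTypeR R)).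
  rewrite (_ : [set r | _] = \bigcup_(j in [set j | odd j = b]) [set r | T k.+1 r = j]).
    by apply: bigcup_measurable => j _; exact: mT.
  apply/seteqP; split => [r <-|r [j /= jb Tj]]; first by exists (T k.+1 r).
  by rewrite /digits Tj.
apply: (measurability cylinder_sys); first exact: measurable_cylinder_sys.
move=> _ [_ [->|[n _ [x _ <-]]] <-]; rewrite setTI.
  by rewrite preimage_set0.
elim: n => [|n IHn]; first by rewrite cylinder0 preimage_setT.
by rewrite cylinderS preimage_setI; apply: measurableI => //; exact: mc.
Qed.

Lemma haar_exists : exists mu : probability dyadic_group R, is_haar mu.
Proof.
pose X : {mfun (measurableTypeR R) >-> dyadic_group} :=
  HB.pack digits (isMeasurableFun.Build _ _ _ _ _ measurable_digits).
exists (distribution (uniform_prob (@ltr01 R)) X); apply: cylinder_haar => n x.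
rewrite [LHS](_ : _ = uniform_prob (@ltr01 R) (digits @^-1` cylinder n x))//.
pose U : set (measurableTypeR R) := digits @^-1` cylinder n x.
pose J : set (measurableTypeR R) := `[(num x n)%:R / 2 ^+ n, (num x n).+1%:R / 2 ^+ n[%classic.
have J01 r : J r -> 0 <= r < 1.
  rewrite /J/= in_itv/= => /andP[r1 r2]; rewrite (le_trans _ r1)//=.
  rewrite (lt_le_trans r2)// ler_pdivrMr ?exprn_gt0// mul1r -natrX ler_nat.
  exact: num_lt.
have UJ : U `&` `[0, 1] = J `|` (U `&` [set 1]).
  apply/seteqP; split => r.
    case=> Ur /=; rewrite in_itv/= => /andP[r0].
    rewrite le_eqVlt => /predU1P[r1|r1]; first by right.
    left; have : T n r = num x n by apply/digitsE => //; rewrite r0.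
    move=> /eqP; rewrite /J/= in_itv/= ler_pdivrMr ?exprn_gt0//.
    rewrite ltr_pdivlMr ?exprn_gt0// mulrC /T truncn_eq// mulr_ge0//.
  case=> [Jr|[Ur r1]]; last first.
    by split=> //; rewrite /= in_itv/= [r]r1 ler01 lexx.
  have /andP[r0 r1] := J01 _ Jr; rewrite /= in_itv/= r0 (ltW r1); split=> //.
  apply/digitsE; first by rewrite r0.
  apply/eqP; rewrite /T truncn_eq ?mulr_ge0//.
  move: Jr; rewrite /J/= in_itv/= ler_pdivrMr ?exprn_gt0//.
  by rewrite ltr_pdivlMr ?exprn_gt0// mulrC.
have mU : measurable (U : set (measurableTypeR R)).
  by rewrite -[U]setTI; apply: measurable_digits => //; exact: measurable_cylinder.
rewrite /uniform_prob integral_uniform_pdf.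
rewrite (eq_integral (fun=> 1%E)); last first.
  by move=> r; rewrite inE => -[_ /=]; rewrite in_itv/= /uniform_pdf => ->; rewrite subr0 invr1.
rewrite integral_cst/=; last exact: measurableI.
have mU1 : measurable (U `&` [set 1]) by exact: measurableI.
have U10 : lebesgue_measure (U `&` [set 1]) = 0%E.
  apply: (@subset_measure0 _ (measurableTypeR R) R lebesgue_measure _ [set 1])=> //.
  exact: lebesgue_measure_set1.
rewrite mul1e UJ measureU0//; last exact: measurable_itv.
rewrite [LHS](lebesgue_measure_itv
  `[(num x n)%:R / 2 ^+ n, (num x n).+1%:R / 2 ^+ n[%R)/= lte_fin ltr_pM2r ?invr_gt0 ?exprn_gt0// ltr_nat ltnSn.
by rewrite -EFinD -mulrBl -natr1 addrAC subrr add0r mul1r exprVn.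
Qed.

End HaarTheory.

Section Walsh.
Context {R : realType}.

Definition rademacher (k : nat) (x : dyadic_group) : R := (-1) ^+ (x k).

Definition bdigit (n k : nat) : nat := odd (n %/ 2 ^ k).

(* The product is finite: the digits of index [k >= n] vanish as [n < 2 ^ n]. *)
Definition walsh (n : nat) (x : dyadic_group) : R :=
  \prod_(k < n) rademacher k x ^+ bdigit n k.

Lemma walsh_cylinder n x y : cylinder n x y -> walsh n y = walsh n x.
Proof. by move=> xy; apply: eq_bigr => k _; rewrite /rademacher xy. Qed.

Lemma normr_walsh n x : `|walsh n x| = 1.
Proof.
by rewrite normr_prod big1// => k _; rewrite !normrX normrN1 !expr1n.
Qed.

Lemma measurable_walsh n : measurable_fun setT (walsh n).
Proof.
move=> _ B mB; rewrite setTI; apply: (@sigma_cylinders_measurable n).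
by apply/sigma_cylindersP => x y /= + xy; rewrite (walsh_cylinder xy).
Qed.

(* The numbers [A_n^beta]. *)
Definition cesaro_num (beta : R) (n : nat) : R :=
  (\prod_(1 <= j < n.+1) (beta + j%:R)) / n`!%:R.

End Walsh.

Section Martingales.
Context {R : realType} (mu : probability dyadic_group R).

Definition integrable_fun (f : dyadic_group -> R) :=
  mu.-integrable [set: dyadic_group] (EFin \o f).

(* [g] is a version of the conditional expectation of [f] given [<<s C >>]. *)
Definition is_cond_exp (C : set (set dyadic_group)) (f g : dyadic_group -> R) :=
  [/\ measurable_fun [set: g_sigma_algebraType C]
        (g : g_sigma_algebraType C -> R),
      integrable_fun g &
      forall A, <<s C >> A ->
        \int[mu]_(x in A) g x = \int[mu]_(x in A) f x].

Definition dyadic_martingale (F : nat -> dyadic_group -> R) :=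
  [/\ forall n, integrable_fun (F n),
      forall n, measurable_fun [set: g_sigma_algebraType (cylinders n)]
        (F n : g_sigma_algebraType (cylinders n) -> R) &
      forall n m, (n <= m)%N -> is_cond_exp (cylinders n) (F m) (F n)].

Definition maximal_function (F : nat -> dyadic_group -> R)
    (x : dyadic_group) : \bar R :=
  ereal_sup [set `|F n x|%:E | n in [set: nat]].

Definition hardy_norm (p : R) (F : nat -> dyadic_group -> R) : \bar R :=
  'N[mu]_(p%:E)[maximal_function F].

Definition hardy_space (p : R) : set (nat -> dyadic_group -> R) :=
  [set F | dyadic_martingale F /\ (hardy_norm p F < +oo)%E].

(* The martingale of an integrable function [f]. As the atoms of the n-th
   sigma-algebra are the cylinders of length n, [E_n f] is an average of [f];
   see [dyadic_exp_cond_exp]. *)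
Definition dyadic_exp (f : dyadic_group -> R) (n : nat)
    (x : dyadic_group) : R :=
  (fine (mu (cylinder n x)))^-1 * \int[mu]_(y in cylinder n x) f y.

Lemma dyadic_exp_cond_exp n f : is_haar mu -> integrable_fun f ->
  is_cond_exp (cylinders n) f (dyadic_exp f n).
Proof.
move=> hmu intf; set g := dyadic_exp f n.
have gE x y : cylinder n x y -> g y = g x.
  by move=> xy; rewrite /g /dyadic_exp (cylinder_eq xy).
have mg : measurable_fun [set: g_sigma_algebraType (cylinders n)]
    (g : g_sigma_algebraType (cylinders n) -> R).
  move=> _ B mB; rewrite setTI; apply/sigma_cylindersP => x y /= Bx xy.
  by rewrite (gE _ _ xy).
have intg : integrable_fun g.
  apply: measurable_bounded_integrable => //.
  - by rewrite [ltLHS](probability_setT mu) ltry.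
  - move=> _ B mB; apply: (@sigma_cylinders_measurable n); exact: mg.
  pose bnd (B : set dyadic_group) := exists M : R, forall y, B y -> `|g y| <= M.
  have [M gM] : bnd setT.
    apply: (@cylinder_ind n) => [x|k x y [M1 gM1] [M2 gM2] _].
      by exists `|g x| => y xy; rewrite (gE _ _ xy).
    exists (Num.max M1 M2) => z; rewrite le_max.
    by case=> [/gM1|/gM2] ->; rewrite ?orbT.
  exists M; split; first exact: num_real.
  by move=> N MN y _ /=; rewrite (le_trans (gM y _) (ltW MN)).
split=> // A sA; have mA := sigma_cylinders_measurable sA.
have intS h B : integrable_fun h -> measurable B -> mu.-integrable B (EFin \o h).
  by move=> ih mB; apply: integrableS ih.
pose Q (B : set dyadic_group) := measurable B /\
  \int[mu]_(y in A `&` B) g y = \int[mu]_(y in A `&` B) f y.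
suff [_] : Q setT by rewrite setIT.
apply: (@cylinder_ind n) => [x|k x y [mx Qx] [my Qy] xy0].
  split; first exact: measurable_cylinder.
  have [Ax|nAx] := pselect (A x).
    rewrite setIidr; last by move=> y; move/sigma_cylindersP : sA; exact.
    rewrite (@eq_Rintegral _ _ _ mu _ (cst (g x))); last first.
      by move=> y; rewrite inE => /gE.
    rewrite Rintegral_cst; last exact: measurable_cylinder.
    rewrite /g /dyadic_exp mulrAC mulVf ?mul1r//.
    rewrite [X in fine X](haar_cylinder _ _ hmu)/=.
    by rewrite expf_neq0// invr_eq0.
  rewrite (_ : _ `&` _ = set0) ?Rintegral_set0//.
  apply/seteqP; split => // y [Ay xy]; apply: nAx.
  move/sigma_cylindersP : sA => /(_ y x Ay); apply=> i im.
  by rewrite xy.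
split; first exact: measurableU.
have dis : [disjoint A `&` cylinder k x & A `&` cylinder k y].
  by apply/disj_set2P; rewrite setIACA xy0 setI0.
rewrite setIUr !Rintegral_setU ?Qx ?Qy//; try exact: measurableI;
  by apply: intS => //; apply: measurableU; exact: measurableI.
Qed.

Definition fourier_coef (F : nat -> dyadic_group -> R) (k : nat) : R :=
  limn (fun n => \int[mu]_x (F n x * walsh k x)).

Lemma integrable_mul_walsh f k :
  integrable_fun f -> integrable_fun (fun x => f x * walsh k x).
Proof.
move=> intf.
apply: (@integrableMl _ _ _ mu _ _ (EFin \o f) (walsh k)) => //.
  exact: measurable_walsh.
exists 1; split; first exact: num_real.
by move=> M M1 x _ /=; rewrite normr_walsh ltW.
Qed.

(* The sequence defining [fourier_coef F k] is constant from rank [k] on. *)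
Lemma fourier_coef_stationary F k n : dyadic_martingale F -> (k <= n)%N ->
  \int[mu]_x (F n x * walsh k x) = \int[mu]_x (F k x * walsh k x).
Proof.
move=> [intF mF EF] kn.
pose P (B : set dyadic_group) := measurable B /\
  \int[mu]_(x in B) (F n x * walsh k x) =
  \int[mu]_(x in B) (F k x * walsh k x).
have intS h B : integrable_fun h -> measurable B ->
    mu.-integrable B (EFin \o h).
  by move=> ih mB; apply: integrableS ih.
suff [] : P setT by [].
apply: (@cylinder_ind k) => [x|i x y [mx Px] [my Py] xy0].
  have mc := measurable_cylinder k x; split => //.
  have wx m : \int[mu]_(z in cylinder k x) (F m z * walsh k z) =
      \int[mu]_(z in cylinder k x) F m z * walsh k x.
    rewrite -RintegralZr//; last exact: intS.
    by apply: eq_Rintegral => z; rewrite inE => /walsh_cylinder ->.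
  rewrite !wx; congr (_ * _); apply/esym.
  by have [_ _] := EF _ _ kn; apply; apply: sub_sigma_algebra; exists x.
split; first exact: measurableU.
have dis : [disjoint cylinder i x & cylinder i y] by apply/disj_set2P.
rewrite !Rintegral_setU ?Px ?Py//; apply: intS; try exact: measurableU;
  exact: integrable_mul_walsh.
Qed.

Lemma fourier_coefE F k : dyadic_martingale F ->
  (fun n => \int[mu]_x (F n x * walsh k x)) @ \oo --> fourier_coef F k /\
  fourier_coef F k = \int[mu]_x (F k x * walsh k x).
Proof.
move=> mF.
have Fk : (fun n => \int[mu]_x (F n x * walsh k x)) @ \oo -->
    \int[mu]_x (F k x * walsh k x).
  apply: cvg_near_cst; exists k => // n /= kn.
  exact: fourier_coef_stationary.
have E : fourier_coef F k = \int[mu]_x (F k x * walsh k x).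
  exact: cvg_lim Fk.
by split=> //; rewrite E.
Qed.

Definition walsh_sum (F : nat -> dyadic_group -> R) (n : nat)
    (x : dyadic_group) : R :=
  \sum_(0 <= k < n) fourier_coef F k * walsh k x.

Definition cesaro_mean (alpha : R) (F : nat -> dyadic_group -> R) (n : nat)
    (x : dyadic_group) : R :=
  (cesaro_num alpha n)^-1 *
  \sum_(1 <= k < n.+1) cesaro_num (alpha - 1) (n - k) * walsh_sum F k x.

End Martingales.

(* Main.v *)
(* Since only the coefficients of index below n matter, F may be replaced by F_n,
   a function of the first n bits, and everything becomes a finite average.

   The kernel of A_m^alpha sigma_m^alpha is Q_m = sum_(j < m) A_(m-1-j)^alpha w_j.
   Monotonicity and concavity of A^alpha give |Q_m(x)| <= C 2^k 2^(alpha l) when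
   k < l are the positions of the first two non-zero bits of x (both truncated at
   the binary length of m). Hence the average of |Q_m| is at most C m^alpha, and if
   E_M is the conditional expectation at level M and p = 1/(1+alpha), the average
   of (E_M |Q_m|)^p is at most C (M + 2^(-M(1-p)) m^(alpha p)).

   Stopping F_n at the levels lambda 2^j yields an atomic decomposition. For an
   atom of level M, sigma_m vanishes if m <= 2^M, and otherwise the p-th power of
   its H_p quasi-norm is at most C (1 + M (2^M / m)^(alpha p)). The weights 1/m
   turn the sum over m <= n into a sum over dyadic blocks: the first term adds up
   to log n, the second one to M <= log n. *)
Require Import Defs.
From mathcomp Require Import all_boot all_order all_algebra.
From mathcomp Require Import all_classical all_reals all_analysis.
From mathcomp Require Import measurable_realfun.
From mathcomp Require Import ring lra zify.

Set Implicit Arguments.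
Unset Strict Implicit.
Unset Printing Implicit Defensive.

Import Order.TTheory GRing.Theory Num.Theory.
Import numFieldNormedType.Exports.

Local Open Scope classical_set_scope.
Local Open Scope ring_scope.

(** The exponent is critical: with b = 2^alpha one has (2 b)^p = 2, that is b^p / 2 = 2^-p. Points
    whose first two non-zero bits are k < l have measure about 2^-l, and 2^(k p) b^(l p) 2^-l =
    2^(-(l - k) p). Summing over l > k leaves a bound independent of k, so every k < M contributes
    equally: this is the origin of the factor M, hence of the logarithm.

    The triangle inequality on the coefficients is too crude for the kernel. After one non-zero bit
    the relevant sums are first differences of A^alpha, after two they are second differences.
    Monotonicity and concavity fix their signs, so the absolute values telescope over the higher
    bits, whatever these are.

    An atom need not live on one cylinder: pieces with the same stopping level stay together. The
    estimate only uses a bound by lambda times the indicator of a union of level-M cylinders and E_M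
    f = 0. Its cost, lambda^p times the measure of that union, sums directly to level sets of the
    maximal function. All constants are independent of N. *)

Section Averages.
Context {R : realType}.
Implicit Types (f g h : dyadic_group -> R) (x y z : dyadic_group).

Definition set_bit (i : nat) (b : bool) x : dyadic_group :=
  fun k => if k == i then b else x k.

(* The average over the coordinates [a, a + c) of the argument. On a function of
   the first [N] coordinates, [avg k (N - k)] is the conditional expectation with
   respect to the cylinders of length [k], and [avg 0 N] is the Haar integral. *)
Fixpoint avg (a c : nat) f x : R :=
  if c is d.+1 then
    (avg a.+1 d f (set_bit a false x) + avg a.+1 d f (set_bit a true x)) / 2
  else f x.

Definition determined n f := forall x y, cylinder n x y -> f y = f x.

Lemma cylinder_set_bit a b x y :
  cylinder a.+1 (set_bit a b x) y -> cylinder a x y.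
Proof.
by move=> xy k ka; rewrite xy 1?ltnW// /set_bit (ltn_eqF ka).
Qed.

Lemma set_bit_id a x : set_bit a (x a) x = x.
Proof. by apply/funext => k; rewrite /set_bit; case: eqP => // ->. Qed.

Lemma le_avg_cylinder a c f g x :
  (forall y, cylinder a x y -> f y <= g y) -> avg a c f x <= avg a c g x.
Proof.
elim: c a x => [|c IH] a x fg /=; first exact: fg.
by rewrite ler_pM2r ?invr_gt0// lerD// IH// => y /cylinder_set_bit; exact: fg.
Qed.

Lemma le_avg a c f g x : (forall y, f y <= g y) -> avg a c f x <= avg a c g x.
Proof. by move=> fg; apply: le_avg_cylinder => y _. Qed.

Lemma eq_avg_cylinder a c f g x :
  (forall y, cylinder a x y -> f y = g y) -> avg a c f x = avg a c g x.
Proof.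
move=> fg; apply/eqP.
by rewrite eq_le !le_avg_cylinder// => y xy; rewrite fg.
Qed.

Lemma eq_avg a c f g x : (forall y, f y = g y) -> avg a c f x = avg a c g x.
Proof. by move=> fg; apply: eq_avg_cylinder => y _. Qed.

Lemma avgD a c f g x :
  avg a c (fun y => f y + g y) x = avg a c f x + avg a c g x.
Proof.
elim: c a x => [|c IH] a x //=; rewrite !IH; lra.
Qed.

Lemma avgZ a c (k : R) f x :
  avg a c (fun y => k * f y) x = k * avg a c f x.
Proof.
elim: c a x => [|c IH] a x //=; rewrite !IH; lra.
Qed.

Lemma avgN a c f x : avg a c (fun y => - f y) x = - avg a c f x.
Proof. by rewrite -mulN1r -avgZ; apply: eq_avg => y; rewrite mulN1r. Qed.

Lemma avgB a c f g x :
  avg a c (fun y => f y - g y) x = avg a c f x - avg a c g x.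
Proof. by rewrite avgD avgN. Qed.

Lemma avg_cst a c (k : R) x : avg a c (fun=> k) x = k.
Proof. by elim: c a x => [|c IH] a x //=; rewrite !IH; lra. Qed.

Lemma avg_sum I (r : seq I) (P : pred I) a c (F : I -> dyadic_group -> R) x :
  avg a c (fun y => \sum_(i <- r | P i) F i y) x =
  \sum_(i <- r | P i) avg a c (F i) x.
Proof.
elim: r => [|i r IH].
  rewrite big_nil -[RHS](avg_cst a c 0 x).
  by apply: eq_avg => y; rewrite big_nil.
rewrite big_cons -IH; case: (boolP (P i)) => Pi; last first.
  by apply: eq_avg => y; rewrite big_cons (negbTE Pi).
by rewrite -avgD; apply: eq_avg => y; rewrite big_cons Pi.
Qed.

Lemma avg_ge0 a c f x : (forall y, 0 <= f y) -> 0 <= avg a c f x.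
Proof. by move=> f0; rewrite -(avg_cst a c 0 x); exact: le_avg. Qed.

Lemma normr_avg a c f x : `|avg a c f x| <= avg a c (fun y => `|f y|) x.
Proof.
by rewrite ler_norml -avgN !le_avg// => y; rewrite ?ler_norm// lerNnormlW.
Qed.

Lemma avg_cat a c d f x : avg a (c + d) f x = avg a c (avg (a + c) d f) x.
Proof.
elim: c a x => [|c IH] a x; first by rewrite addn0.
by rewrite addSn /= !IH addSnnS.
Qed.

Lemma determinedW m n f : (m <= n)%N -> determined m f -> determined n f.
Proof. by move=> mn mf x y xy; apply: mf; exact: cylinder_sub mn _ xy. Qed.

Lemma determined_avg n a c f :
  (n <= a + c)%N -> determined n f -> determined a (avg a c f).
Proof.
elim: c a => [|c IH] a nac nf; first by apply: determinedW nf; rewrite addn0 in nac.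
have {}IH : determined a.+1 (avg a.+1 c f) by apply: IH => //; rewrite addSnnS.
have step b x y : cylinder a x y ->
    avg a.+1 c f (set_bit a b y) = avg a.+1 c f (set_bit a b x).
  move=> xy; apply: IH => k; rewrite ltnS leq_eqVlt /set_bit.
  by case: eqP => [//|_ /= ka]; exact: xy.
by move=> x y xy /=; rewrite !(step _ x y).
Qed.

Lemma avg_pull a c g f x : determined a g ->
  avg a c (fun y => g y * f y) x = g x * avg a c f x.
Proof.
move=> ga; rewrite -avgZ; apply: eq_avg_cylinder => y xy.
by rewrite (ga _ _ xy).
Qed.

Lemma avg_id a c f x : determined a f -> avg a c f x = f x.
Proof.
move=> fa; rewrite -[RHS](avg_cst a c _ x).
by apply: eq_avg_cylinder => y xy; exact: fa.
Qed.

Lemma avg_widen n a c d f x : determined n f -> (n <= a + c)%N ->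
  avg a (c + d) f x = avg a c f x.
Proof.
move=> nf nac; rewrite avg_cat; apply: eq_avg => y.
by apply: avg_id; exact: determinedW nf.
Qed.

Lemma dyadic_add_set_bit y a b x :
  dyadic_add y (set_bit a b x) = set_bit a (b (+) y a) (dyadic_add y x).
Proof.
apply/funext => k; rewrite /dyadic_add /set_bit.
by case: eqP => // ->; rewrite addbC.
Qed.

(** Translating by [y] either keeps or exchanges the two branches at each averaged bit, and their
    sum is symmetric. *)
Lemma avg_translate a c f y x :
  avg a c (fun t => f (dyadic_add y t)) x = avg a c f (dyadic_add y x).
Proof.
elim: c a x => [|c IH] a x //=; rewrite !IH !dyadic_add_set_bit.
by case: (y a) => //=; rewrite addrC.
Qed.

Lemma dyadic_addC x y : dyadic_add x y = dyadic_add y x.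
Proof. by apply/funext => k; rewrite /dyadic_add addbC. Qed.

Lemma avg_translateC a c f y x :
  avg a c (fun t => f (dyadic_add t y)) x = avg a c f (dyadic_add x y).
Proof.
by rewrite -dyadic_addC -avg_translate; apply: eq_avg => t; rewrite dyadic_addC.
Qed.

Lemma determined_translate n f y :
  determined n f -> determined n (fun t => f (dyadic_add y t)).
Proof. by move=> nf u v uv; apply: nf => k kn; rewrite /dyadic_add uv. Qed.

Lemma avg_swap a c a' c' (h : dyadic_group -> dyadic_group -> R) x t :
  avg a c (fun y => avg a' c' (h y) t) x =
  avg a' c' (fun u => avg a c (h^~ u) x) t.
Proof.
elim: c a x => [|c IH] a x //=; rewrite !IH.
rewrite -avgD mulrC -avgZ; apply: eq_avg => u; exact: mulrC.
Qed.

(** The point [x] is itself one of the 2^c points over which the average runs. *)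
Lemma avg_ge_cylinder a c f x : (forall y, 0 <= f y) ->
  f x <= 2 ^+ c * avg a c f x.
Proof.
move=> f0; elim: c a x => [|c IH] a x /=; first by rewrite mul1r.
have := avg_ge0 a.+1 c (set_bit a (~~ x a) x) f0.
have E : avg a.+1 c f (set_bit a false x) + avg a.+1 c f (set_bit a true x) =
    avg a.+1 c f x + avg a.+1 c f (set_bit a (~~ x a) x).
  by have := set_bit_id a x; case: (x a) => /= ->; rewrite // addrC.
rewrite E => H; rewrite [leRHS](_ : _ = 2 ^+ c * avg a.+1 c f x +
  2 ^+ c * avg a.+1 c f (set_bit a (~~ x a) x)); last by rewrite exprS; field.
by rewrite -[leLHS]addr0 lerD ?IH// mulr_ge0// exprn_ge0.
Qed.

End Averages.

(** * Cesàro numbers: growth, monotonicity and concavity *)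

Section CesaroNumbers.
Context {R : realType}.

Lemma cesaro_num0 (a : R) : cesaro_num a 0 = 1.
Proof. by rewrite /cesaro_num big_nil fact0 divr1. Qed.

Lemma cesaro_numS (a : R) n :
  cesaro_num a n.+1 = cesaro_num a n * (1 + a / n.+1%:R).
Proof.
rewrite /cesaro_num big_nat_recr//= factS natrM.
have f0 : (n`!)%:R != 0 :> R by rewrite pnatr_eq0 -lt0n fact_gt0.
have n0 : n.+1%:R != 0 :> R by rewrite pnatr_eq0.
by move: f0 n0; move: (n`!%:R) (n.+1%:R) => u v u0 v0; field; rewrite u0 v0.
Qed.

Lemma cesaro_num_pred (a : R) n :
  cesaro_num (a - 1) n.+1 = cesaro_num a n.+1 - cesaro_num a n.
Proof.
elim: n => [|n IH].
  by rewrite !cesaro_numS !cesaro_num0; field.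
rewrite cesaro_numS IH !cesaro_numS.
have n1 : n.+1%:R != 0 :> R by rewrite pnatr_eq0.
have n2 : n.+2%:R != 0 :> R by rewrite pnatr_eq0.
rewrite -(natr1 n.+1) -(natr1 n) in n2 *; rewrite -(natr1 n) in n1.
by field; rewrite n1 n2.
Qed.

Lemma cesaro_num_sum (a : R) n :
  \sum_(0 <= k < n.+1) cesaro_num (a - 1) k = cesaro_num a n.
Proof.
elim: n => [|n IH]; first by rewrite big_nat1 !cesaro_num0.
by rewrite big_nat_recr//= IH cesaro_num_pred addrC subrK.
Qed.

(** Concavity of the logarithm between 1 + u and 1, with weights a and 1 - a. *)
Lemma bernoulli_powR (a u : R) : 0 < a -> a < 1 -> -1 < u ->
  (1 + u) `^ a <= 1 + a * u.
Proof.
move=> a0 a1 u1.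
have u0 : 0 < 1 + u by lra.
have [au0 au1] : 0 <= a /\ a <= 1 by lra.
have w0 : 0 < 1 + a * u by nra.
rewrite -ler_ln ?posrE ?powR_gt0// ln_powR.
have := @concave_ln R (Itv01 au0 au1) _ _ u0 ltr01.
rewrite !convRE/= ln1 mulr0 addr0 mulr1.
by rewrite (_ : a * (1 + u) + (1 - a) = 1 + a * u)//; ring.
Qed.

Section Power.
Variable a : R.
Hypotheses (a0 : 0 < a) (a1 : a < 1).
Local Notation A := (cesaro_num a).

Lemma cesaro_num_gt0 n : 0 < A n.
Proof.
elim: n => [|n IH]; first by rewrite cesaro_num0.
by rewrite cesaro_numS mulr_gt0// addr_gt0// divr_gt0.
Qed.

Lemma cesaro_num_incr n : A n.+1 - A n = a * A n / n.+1%:R.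
Proof. by rewrite cesaro_numS mulrDr mulr1 addrC addKr mulrCA mulrA. Qed.

Lemma cesaro_num_le m n : (m <= n)%N -> A m <= A n.
Proof.
move=> /subnK <-; elim: (n - m)%N => //= k IH.
rewrite addSn (le_trans IH)// -subr_ge0 cesaro_num_incr.
by rewrite divr_ge0// mulr_ge0 ?ltW// cesaro_num_gt0.
Qed.

(** Consecutive increments have ratio (n + 1 + a) / (n + 2), which is at most 1 because a < 1. *)
Lemma cesaro_num_concave1 n : A n.+2 - A n.+1 <= A n.+1 - A n.
Proof.
rewrite !cesaro_num_incr cesaro_numS.
have A0 := cesaro_num_gt0 n.
rewrite ler_pdivrMr// [leRHS]mulrAC ler_pdivlMr//.
have n0 : 0 < n.+1%:R :> R by [].
rewrite -(natr1 n.+1); set k := n.+1%:R in n0 *.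
rewrite (_ : _ * k = a * A n * (k + a)); last by field; rewrite gt_eqF.
by rewrite ler_wpM2l ?(mulr_ge0 (ltW a0) (ltW A0)) ?lerD2l ?(ltW a1).
Qed.

Lemma cesaro_num_concaveS h m n : (m <= n)%N ->
  A (n + h) - A n <= A (m + h) - A m.
Proof.
move=> mn.
have mono i j : (i <= j)%N -> A j.+1 - A j <= A i.+1 - A i.
  move=> /subnK <-; elim: (j - i)%N => //= k IH.
  by rewrite addSn (le_trans (cesaro_num_concave1 _)).
elim: h => [|h IH]; first by rewrite !addn0 !subrr.
have := mono (m + h)%N (n + h)%N (leq_add mn (leqnn _)).
by rewrite !addnS; move: IH; lra.
Qed.

Lemma cesaro_num_ge n : n.+1%:R `^ a <= A n.
Proof.
elim: n => [|n IH]; first by rewrite cesaro_num0 powR1.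
have n0 : 0 < n.+1%:R :> R by [].
rewrite -natr1 (_ : n.+1%:R + 1 = n.+1%:R * (1 + n.+1%:R^-1)); last first.
  by field; rewrite gt_eqF.
rewrite powRM ?addr_ge0// cesaro_numS ler_pM ?powR_ge0//.
by apply: bernoulli_powR => //; rewrite (@lt_trans _ _ 0)// ?invr_gt0// ltrN10.
Qed.

Lemma cesaro_num_ub n : A n.+1 <= 2 * n.+1%:R `^ a.
Proof.
elim: n => [|n IH].
  rewrite cesaro_numS cesaro_num0 powR1 divr1 mul1r mulr1 (_ : 2 = 1 + 1)//.
  by rewrite lerD2l ltW.
have n0 : 0 < n.+1%:R :> R by [].
have n2 : 0 < n.+2%:R :> R by [].
have nE : n.+2%:R = n.+1%:R + 1 :> R by rewrite natr1.
have u0 : 0 <= 1 + a / n.+2%:R by rewrite addr_ge0// divr_ge0// ltW.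
rewrite cesaro_numS (le_trans (ler_wpM2r u0 IH))//.
rewrite -mulrA ler_pM2l//.
(* Bernoulli at u = -1/(n+2) bounds (n+1)^a by (1 - a/(n+2)) (n+2)^a. Multiplied by the growth
   factor 1 + a/(n+2), this leaves 1 - (a/(n+2))^2 <= 1. *)
have u1 : -1 < - n.+2%:R^-1 :> R.
  by rewrite ltrN2 invf_lt1 ?posrE// nE ltrDr.
have := bernoulli_powR a0 a1 u1.
have -> : 1 - n.+2%:R^-1 = n.+1%:R / n.+2%:R :> R.
  have n2' : n.+2%:R != 0 :> R by rewrite gt_eqF.
  by apply: (mulIf n2'); rewrite mulrBl mul1r mulVf// divfK// nE addrK.
rewrite powRM ?invr_ge0// -{1}[n.+2%:R^-1]powR_inv1// powRAC.
rewrite powR_inv1 ?powR_ge0// ler_pdivrMr ?powR_gt0// => H.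
rewrite (le_trans (ler_wpM2r u0 H))//.
rewrite mulrAC -[leRHS]mul1r ler_wpM2r ?powR_ge0//.
rewrite (_ : _ * _ = 1 - (a / n.+2%:R) ^+ 2); last by ring.
by rewrite gerBl sqr_ge0.
Qed.

End Power.
End CesaroNumbers.

(** * Walsh functions under addition and digit reflection *)

Section WalshFunctions.
Context {R : realType}.
Implicit Types x y : dyadic_group.
Local Notation walsh := (@walsh R).
Local Notation rademacher := (@rademacher R).

Lemma bdigit_small n k : (n < 2 ^ k)%N -> bdigit n k = 0%N.
Proof. by move=> nk; rewrite /bdigit divn_small. Qed.

Lemma walshE K n x : (n < 2 ^ K)%N ->
  walsh n x = \prod_(k < K) rademacher k x ^+ bdigit n k.
Proof.
have widen a b : (n < 2 ^ a)%N -> (a <= b)%N ->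
    \prod_(k < b) rademacher k x ^+ bdigit n k =
    \prod_(k < a) rademacher k x ^+ bdigit n k.
  move=> na /subnKC <-; rewrite big_split_ord/= [X in _ * X]big1 ?mulr1// => k _.
  by rewrite bdigit_small ?expr0// (leq_trans na)// leq_exp2l// leq_addr.
move=> nK; rewrite /Defs.walsh.
have [/(widen _ _ nK)//|/ltnW Kn] := leqP K n.
by rewrite [RHS](widen n) // ltn_expl.
Qed.

Lemma determined_walsh K n : (n < 2 ^ K)%N -> determined K (walsh n).
Proof.
move=> nK x y xy; rewrite !(walshE _ nK).
by apply: eq_bigr => k _; rewrite /Defs.rademacher xy.
Qed.

Lemma walsh0 x : walsh 0 x = 1.
Proof. by rewrite (@walshE 0) ?big_ord0. Qed.

Lemma walsh_dyadic_add n x y :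
  walsh n (dyadic_add x y) = walsh n x * walsh n y.
Proof.
rewrite /Defs.walsh -big_split; apply: eq_bigr => k _ /=.
by rewrite -exprMn /Defs.rademacher /dyadic_add signr_addb.
Qed.

Lemma walsh_pow2D s i x : (i < 2 ^ s)%N ->
  walsh (2 ^ s + i) x = rademacher s x * walsh i x.
Proof.
move=> is_; rewrite (walshE _ is_) (@walshE s.+1); last first.
  by rewrite expnS mul2n -addnn ltn_add2l.
rewrite big_ord_recr/= mulrC; congr (_ * _).
  by rewrite /bdigit -{1}[(2 ^ s)%N]mul1n divnMDl ?expn_gt0// divn_small.
apply: eq_bigr => -[k ks] _ /=; rewrite /bdigit divnDl ?dvdn_exp2l 1?ltnW// oddD.
rewrite (_ : odd (2 ^ s %/ 2 ^ k) = false)//.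
by rewrite -expnB ?(ltnW ks)// oddX subn_eq0 leqNgt ks.
Qed.

(** The number 2^s - 1 - i has the complementary binary digits of i, and every Rademacher function
    has square 1. *)
Lemma walsh_reflect s i x : (i < 2 ^ s)%N ->
  walsh (2 ^ s - i.+1) x = walsh (2 ^ s).-1 x * walsh i x.
Proof.
elim: s i => [|s IH] i.
  by rewrite expn0 ltnS leqn0 => /eqP ->; rewrite !walsh0 mulr1.
have p0 : (0 < 2 ^ s)%N by rewrite expn_gt0.
rewrite expnS mul2n -addnn => is2.
have -> : (2 ^ s + 2 ^ s).-1 = (2 ^ s + (2 ^ s).-1)%N by lia.
rewrite [in RHS]walsh_pow2D; last by lia.
have [is1|is1] := ltnP i (2 ^ s).
  have -> : (2 ^ s + 2 ^ s - i.+1 = 2 ^ s + (2 ^ s - i.+1))%N by lia.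
  by rewrite walsh_pow2D ?IH ?mulrA//; lia.
have -> : (2 ^ s + 2 ^ s - i.+1 = 2 ^ s - (i - 2 ^ s).+1)%N by lia.
rewrite IH; last by lia.
rewrite -{2}(subnKC is1) walsh_pow2D; last by lia.
rewrite mulrACA mulrCA -!mulrA; congr (_ * _).
by rewrite mulrA /Defs.rademacher -expr2 sqrr_sign mul1r.
Qed.

End WalshFunctions.

(** * Pointwise bounds for the Cesàro kernel *)

Section Kernel.
Context {R : realType}.
Variable a : R.
Hypotheses (a0 : 0 < a) (a1 : a < 1).
Implicit Types x y : dyadic_group.
Local Notation A := (cesaro_num a).
Local Notation walsh := (@walsh R).
Local Notation rademacher := (@rademacher R).
Local Notation b := (2 `^ a).

(* The numerator of the kernel: summing by parts turns the weights
   [A_(m-k)^(a-1)] of the partial sums into [A_(m-j-1)^a] on [walsh j]. *)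
Definition cesaro_kernel m x : R := \sum_(j < m) A (m - j.+1) * walsh j x.
Local Notation kernel := cesaro_kernel.

(** The free offset [q] makes the family stable under halving: both halves of a block are again
    blocks, up to a Rademacher sign. *)
Definition block i q x : R := \sum_(j < 2 ^ i) A (q + j) * walsh j x.

Lemma determined_kernel m i : (m <= 2 ^ i)%N -> determined i (kernel m).
Proof.
move=> mi x y xy; apply: eq_bigr => j _; congr (_ * _).
by apply: determined_walsh xy; exact: leq_trans mi.
Qed.

Lemma blockS i q x :
  block i.+1 q x = block i q x + rademacher i x * block i (q + 2 ^ i) x.
Proof.
rewrite /block expnS mul2n -addnn big_split_ord/=; congr (_ + _).
rewrite mulr_sumr; apply: eq_bigr => j _.
by rewrite walsh_pow2D// mulrCA addnA.
Qed.

(* The reflection [j -> 2 ^ i - 1 - j] multiplies [walsh j] by the function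
   [walsh (2 ^ i - 1)], so the lower half becomes a block with increasing
   coefficients. *)
Lemma kernelD i m x : (m <= 2 ^ i)%N ->
  kernel (2 ^ i + m) x =
  walsh (2 ^ i).-1 x * block i m x + rademacher i x * kernel m x.
Proof.
move=> mi; rewrite /cesaro_kernel big_split_ord/=; congr (_ + _).
  rewrite (reindex_inj rev_ord_inj)/= mulr_sumr; apply: eq_bigr => j _.
  rewrite walsh_reflect// mulrCA; congr (_ * (A _ * _)).
  by have := ltn_ord j; lia.
rewrite mulr_sumr; apply: eq_bigr => j _.
rewrite walsh_pow2D; last exact: leq_trans mi.
by rewrite mulrCA; congr (_ * (A _ * _)); have := ltn_ord j; lia.
Qed.

Lemma normr_kernelD i m x : (m <= 2 ^ i)%N ->
  `|kernel (2 ^ i + m) x| <= `|block i m x| + `|kernel m x|.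
Proof.
move=> mi; rewrite kernelD// (le_trans (ler_normD _ _))// !normrM.
by rewrite normr_walsh /Defs.rademacher normr_sign !mul1r.
Qed.

(* The bounds telescope when [i] grows, whatever the signs of the higher bits. *)
Lemma block_tail i0 x (phi : nat -> R) :
  (forall q, `|block i0 q x| <= phi (q + 2 ^ i0)%N - phi q) ->
  forall i q, (i0 <= i)%N -> `|block i q x| <= phi (q + 2 ^ i)%N - phi q.
Proof.
move=> H i q /subnK <-; elim: (i - i0)%N q => [//|n IH] q.
rewrite addSn blockS (le_trans (ler_normD _ _))// normrM.
rewrite /Defs.rademacher normr_sign mul1r expnS mul2n -addnn addnA.
have := IH q; have := IH (q + 2 ^ (n + i0))%N; lra.
Qed.

Definition low_sum k q : R := \sum_(d < 2 ^ k) A (q + d).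

Lemma low_sumB k q h : low_sum k (q + h)%N - low_sum k q <=
  2 ^+ k * (A (q + h)%N - A q).
Proof.
rewrite -sumrB -natrX mulr_natl.
rewrite -[in leRHS](card_ord (2 ^ k)) -sumr_const; apply: ler_sum => d _.
by rewrite addnAC; apply: cesaro_num_concaveS => //; rewrite leq_addr.
Qed.

Lemma low_sum_le k q h : (q <= h)%N -> low_sum k q <= low_sum k h.
Proof.
move=> qh; apply: ler_sum => d _; apply: cesaro_num_le => //.
by rewrite leq_add2r.
Qed.

Lemma block_zero k q x : (forall t, (t < k)%N -> x t = false) ->
  block k q x = low_sum k q.
Proof.
elim: k q => [|k IH] q xk.
  by rewrite /block /low_sum !big_ord1 walsh0 mulr1.
have xk' t : (t < k)%N -> x t = false by move=> tk; apply: xk; exact: ltnW.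
rewrite blockS !IH// /Defs.rademacher xk// expr0 mul1r.
rewrite /low_sum expnS mul2n -addnn big_split_ord/=; congr (_ + _).
by apply: eq_bigr => j _; rewrite addnA.
Qed.

Section OneBit.
Variables (k : nat) (x : dyadic_group).
Hypotheses (xk0 : forall t, (t < k)%N -> x t = false) (xk : x k = true).

Lemma block_bit q :
  block k.+1 q x = low_sum k q - low_sum k (q + 2 ^ k).
Proof. by rewrite blockS !block_zero// /Defs.rademacher xk expr1 mulN1r. Qed.

(** The sign at bit [k] turns the smallest block into a difference of two low sums, of known sign by
    monotonicity. Enlarging the shift from 2^k to 2^(k+1) gives the form that [block_tail]
    telescopes, with potential [low_sum k]. *)
Lemma block_one_bit i q : (k < i)%N ->
  `|block i q x| <= 2 ^+ k * (A (q + 2 ^ i) - A q).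
Proof.
move=> ki; apply: le_trans (low_sumB _ _ _).
apply: block_tail ki => {}q; rewrite block_bit distrC ger0_norm; last first.
  by rewrite subr_ge0 low_sum_le// leq_addr.
by rewrite lerD2r low_sum_le// leq_add2l leq_exp2l.
Qed.

Section TwoBits.
Variable l : nat.
Hypotheses (kl : (k < l)%N) (xkl : forall t, (k < t < l)%N -> x t = false).
Hypothesis (xl : x l = true).

(** At length k + 1 the block is minus a difference of low sums: negative since A is increasing, and
    monotone in [q] since A is concave. Zero bits between k and l only add such blocks, which
    preserves both properties. *)
Lemma block_two_bits_mono :
  (forall q, block l q x <= 0) /\
  (forall q r, (q <= r)%N -> block l q x <= block l r x).
Proof.
suff H i : (k + i.+1 <= l)%N -> (forall q, block (k + i.+1) q x <= 0) /\
    (forall q r, (q <= r)%N -> block (k + i.+1) q x <= block (k + i.+1) r x).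
  by have := H (l - k.+1)%N; rewrite -addSnnS subnKC//; exact.
elim: i => [|i IH] il.
  rewrite addn1; split=> [q|q r qr]; rewrite !block_bit.
    by rewrite subr_le0 low_sum_le// leq_addr.
  rewrite -!sumrB; apply: ler_sum => d _.
  have := @cesaro_num_concaveS _ a a0 a1 (2 ^ k) (q + d) (r + d).
  by rewrite leq_add2r => /(_ qr); rewrite !(addnAC _ (2 ^ k)%N); lra.
have {IH}[H0 H1] := IH (ltac:(lia)).
have r1 : rademacher (k + i.+1) x = 1.
  by rewrite /Defs.rademacher xkl ?expr0//; lia.
split=> [q|q r qr]; rewrite addnS !blockS r1 !mul1r.
  by have := H0 q; have := H0 (q + 2 ^ (k + i.+1))%N; lra.
by apply: lerD; apply: H1; rewrite ?leq_add2r.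
Qed.

Lemma block_two_bits i q : (l <= i)%N ->
  `|block i q x| <= 2 ^+ k * (A (q + 2 ^ l) - A q).
Proof.
have [g0 g1] := block_two_bits_mono.
rewrite leq_eqVlt => /predU1P[<-|li]; first exact: block_one_bit.
apply: le_trans (block_one_bit q kl).
rewrite (ler0_norm (g0 q)).
(* The block of length l serves as its own potential. As it is nonpositive, the telescoped
   difference is at most its absolute value at [q], whatever i is. *)
have := @block_tail l.+1 x (fun q => block l q x) _ i q li.
move=> H; apply: (le_trans (H _)); last first.
  by have := g0 (q + 2 ^ i)%N; lra.
move=> {H}r; rewrite blockS /Defs.rademacher xl expr1 mulN1r.
rewrite distrC ger0_norm; last by rewrite subr_ge0 g1// leq_addr.
by rewrite lerD2r g1// leq_add2l leq_exp2l.
Qed.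

End TwoBits.
End OneBit.

Lemma two_powR_gt1 : 1 < b.
Proof.
rewrite /powR pnatr_eq0/= -[ltLHS]expR0 ltr_expR mulr_gt0//.
by rewrite ln_gt0// ltr1n.
Qed.

Lemma two_powR_lt2 : b < 2.
Proof.
rewrite -[ltRHS]powRr1// /powR pnatr_eq0/= ltr_expR mul1r.
by rewrite gtr_pMl// ln_gt0// ltr1n.
Qed.

Let b0 : 0 < b := lt_trans ltr01 two_powR_gt1.

Lemma pow2_powR i : (2 ^ i)%:R `^ a = b ^+ i :> R.
Proof. by rewrite natrX -powR_mulrn// -powRrM mulrC powRrM powR_mulrn// ltW. Qed.

Lemma cesaro_num_pow2 m i : (m <= 2 ^ i)%N -> A m <= 2 * b ^+ i.
Proof.
move=> mi; rewrite (le_trans (cesaro_num_le a0 mi))//.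
rewrite -pow2_powR -(@prednK (2 ^ i)) ?expn_gt0//.
exact: cesaro_num_ub.
Qed.

(** The first term sums a series growing like b^i over the digits below the second bit, the last one
    a series decaying like (b/2)^i over the digits above it. The middle 2 bounds the initial value
    of the potential in the two-bit estimate. *)
Definition kernel_cst : R := 4 / (b - 1) + 2 + 4 / (2 - b).

Let K1 : R := 4 / (b - 1).
Let K2 : R := 4 / (2 - b).
Let K1E : K1 * (b - 1) = 4.
Proof. by rewrite divfK// subr_eq0 gt_eqF// two_powR_gt1. Qed.
Let K2E : K2 * (2 - b) = 4.
Proof. by rewrite divfK// subr_eq0 gt_eqF// two_powR_lt2. Qed.
Let K1_ge : 4 <= K1.
Proof.
rewrite /K1 ler_pdivlMr ?subr_gt0 ?two_powR_gt1//.
by have := two_powR_lt2; lra.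
Qed.
Let K2_ge : 4 <= K2.
Proof.
rewrite /K2 ler_pdivlMr ?subr_gt0 ?two_powR_lt2//.
by have := two_powR_gt1; lra.
Qed.

Lemma kernel_cst_gt0 : 0 < kernel_cst.
Proof. by rewrite /kernel_cst -/K1 -/K2; have := K1_ge; have := K2_ge; lra. Qed.

Lemma kernel_bound m i x : (m <= 2 ^ i)%N ->
  `|kernel m x| <= 2 * 2 ^+ i * b ^+ i.
Proof.
move=> mi; rewrite (le_trans (ler_norm_sum _ _ _))//.
rewrite (@le_trans _ _ (\sum_(j < m) 2 * b ^+ i))//.
  apply: ler_sum => j _; rewrite normrM normr_walsh mulr1.
  by rewrite gtr0_norm ?cesaro_num_gt0// cesaro_num_pow2//; lia.
rewrite sumr_const card_ord -[leLHS]mulr_natr [leLHS]mulrAC.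
rewrite ler_wpM2r ?exprn_ge0 ?(ltW b0)//.
by rewrite ler_pM2l// -natrX ler_nat.
Qed.

Section KernelBits.
Variables (k : nat) (x : dyadic_group).
Hypotheses (xk0 : forall t, (t < k)%N -> x t = false) (xk : x k = true).

Let kernel_one m i : (k <= i)%N -> (m <= 2 ^ i)%N ->
  `|kernel m x| <= K1 * 2 ^+ k * b ^+ i.
Proof.
move=> /subnK <-; elim: (i - k)%N m => [|n IH] m mn.
  rewrite (le_trans (kernel_bound _ mn))// !ler_pM2r ?exprn_gt0//.
  by have := K1_ge; lra.
have bn : 0 < b ^+ (n + k) by rewrite exprn_gt0.
have k2 : 0 < 2 ^+ k :> R by rewrite exprn_gt0.
have [mnk|mnk] := leqP m (2 ^ (n + k)).
  rewrite (le_trans (IH _ mnk))// ler_wpM2l//.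
    by rewrite mulr_ge0 ?(ltW k2)//; have := K1_ge; lra.
  by rewrite ler_eXn2l ?two_powR_gt1.
have mn' : (m - 2 ^ (n + k) <= 2 ^ (n + k))%N.
  by move: mn; rewrite addSn expnS; lia.
rewrite -(subnKC (ltnW mnk)) (le_trans (normr_kernelD _ mn'))//.
(* [K1] is chosen so that K1 (b - 1) = 4: passing from exponent n + k to n + k + 1 pays exactly for
   this block. *)
suff B : `|block (n + k) (m - 2 ^ (n + k)) x| <= 4 * 2 ^+ k * b ^+ (n + k).
  rewrite (le_trans (lerD B (IH _ mn')))// addSn exprS.
  by rewrite le_eqVlt -{1}K1E; apply/orP; left; apply/eqP; ring.
(* A block of length k does not see the bit at [k]: there is no cancellation, and its 2^k
   coefficients are bounded one by one. *)
case: n mn {IH} mn' bn {mnk} => [|n] mn mn' bn.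
  rewrite add0n block_zero// (@le_trans _ _ (\sum_(d < 2 ^ k) (4 * b ^+ k)))//.
    apply: (le_trans (ler_norm_sum _ _ _)); apply: ler_sum => d _.
    rewrite ger0_norm; last by rewrite ltW// cesaro_num_gt0.
    rewrite (le_trans (@cesaro_num_pow2 _ k.+1 _))//.
      by have := ltn_ord d; move: mn'; rewrite add0n expnS; lia.
    rewrite exprS mulrA ler_wpM2r ?exprn_ge0 ?(ltW b0)//.
    by have := two_powR_lt2; lra.
  by rewrite sumr_const card_ord -[leLHS]mulr_natr natrX mulrAC.
have kn : (k < n.+1 + k)%N by rewrite addSn ltnS leq_addl.
apply: le_trans (block_one_bit xk0 xk _ kn) _.
rewrite [leRHS]mulrAC mulrC ler_pM2r//.
have := @cesaro_num_concaveS _ a a0 a1 (2 ^ (n.+1 + k)) 0 (m - 2 ^ (n.+1 + k)) isT.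
move=> /le_trans; apply; rewrite cesaro_num0 add0n.
have := cesaro_num_pow2 (leqnn (2 ^ (n.+1 + k))).
lra.
Qed.

Lemma kernel_one_bit m i : (k <= i)%N -> (m <= 2 ^ i)%N ->
  `|kernel m x| <= kernel_cst * 2 ^+ k * b ^+ i.
Proof.
move=> ki mi; rewrite (le_trans (kernel_one ki mi))//.
rewrite ler_pM2r ?exprn_gt0// ler_pM2r ?exprn_gt0// /kernel_cst -/K1 -/K2.
by have := K2_ge; lra.
Qed.

(* Peeling off the leading binary digit of [m] costs [2 ^ k * D m'], with [m'] the
   remaining part; hence the potential [`|kernel m x| + 2 ^ k * D m], in which the
   cost of each digit is charged to the next one. *)
Lemma kernel_two_bits l m : (k < l)%N ->
  (forall t, (k < t < l)%N -> x t = false) -> x l = true ->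
  `|kernel m x| <= kernel_cst * 2 ^+ k * b ^+ l.
Proof.
move=> kl xkl xl; pose D m := A (m + 2 ^ l) - A m.
have D_le i j : (i <= j)%N -> D j <= D i by exact: cesaro_num_concaveS.
have D0 i : 0 <= D i by rewrite subr_ge0 cesaro_num_le// leq_addr.
have k2 : 0 < 2 ^+ k :> R by rewrite exprn_gt0.
have Dpow i : D (2 ^ i)%N <= 2 * 2 ^+ l * (b / 2) ^+ i.
  have -> : D (2 ^ i)%N = \sum_(h < 2 ^ l) (A (2 ^ i + h.+1) - A (2 ^ i + h)).
    elim: (2 ^ l)%N @D {D_le D0} => [|h IH] D; first by rewrite big_ord0 /D addn0 subrr.
    by rewrite big_ord_recr/= -IH /D; lra.
  rewrite (@le_trans _ _ (\sum_(h < 2 ^ l) (2 * (b / 2) ^+ i)))//; last first.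
    by rewrite sumr_const card_ord -[leLHS]mulr_natr natrX mulrAC.
  apply: ler_sum => h _.
  have := @cesaro_num_concaveS _ a a0 a1 1 (2 ^ i) (2 ^ i + h) (leq_addr _ _).
  rewrite -addnA !addn1 addnS => /le_trans; apply.
  rewrite cesaro_num_incr ler_pdivrMr// exprMn exprVn.
  apply: (@le_trans _ _ (A (2 ^ i))).
    by rewrite ler_piMl ?(ltW a1)// ltW// cesaro_num_gt0.
  rewrite (le_trans (cesaro_num_pow2 (leqnn _)))// -!mulrA ler_pM2l//.
  rewrite ler_peMr ?exprn_ge0 ?(ltW b0)// mulrC ler_pdivlMr ?exprn_gt0//.
  by rewrite mul1r -natrX ler_nat.
have claim i : (l <= i)%N -> forall m, (m <= 2 ^ i)%N ->
    `|kernel m x| + 2 ^+ k * D m <=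
    2 ^+ k * ((K1 + 2) * b ^+ l + K2 * 2 ^+ l * ((b / 2) ^+ l - (b / 2) ^+ i)).
  move=> /subnK <-; elim: (i - l)%N => [|n IH] {}m mn.
    rewrite add0n subrr mulr0 addr0 mulrDl mulrDr mulrCA mulrA.
    rewrite lerD// ?kernel_one// 1?ltnW// ler_pM2l//.
    rewrite (le_trans (D_le 0%N _ _))// /D cesaro_num0 add0n.
    by have := cesaro_num_pow2 (leqnn (2 ^ l)); lra.
  have bb : 0 < (b / 2) ^+ (n + l) by rewrite exprn_gt0// divr_gt0.
  have l2 : 0 < 2 ^+ l :> R by rewrite exprn_gt0.
  have K20 : 0 < K2 by have := K2_ge; lra.
  have [mnk|mnk] := leqP m (2 ^ (n + l)).
    rewrite (le_trans (IH _ mnk))// ler_pM2l// lerD2l ler_pM2l ?(mulr_gt0 K20 l2)//.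
    rewrite lerD2l lerN2 addSn exprS ger_pMl//.
    by have := two_powR_lt2; lra.
  have mn' : (m - 2 ^ (n + l) <= 2 ^ (n + l))%N.
    by move: mn; rewrite addSn expnS; lia.
  have H1 := IH _ mn'.
  have H2 : 2 ^+ k * D m <= 2 ^+ k * (2 * 2 ^+ l * (b / 2) ^+ (n + l)).
    by rewrite ler_pM2l// (le_trans (D_le _ _ (ltnW mnk))).
  have H3 := normr_kernelD x mn'; rewrite subnKC ?(ltnW mnk)// in H3.
  have H4 := block_two_bits xk0 xk kl xkl xl (m - 2 ^ (n + l)) (leq_addl n l).
  rewrite (_ : (K1 + 2) * _ + _ =
    (K1 + 2) * b ^+ l + K2 * 2 ^+ l * ((b / 2) ^+ l - (b / 2) ^+ (n + l)) +
    2 * 2 ^+ l * (b / 2) ^+ (n + l)); last first.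
    rewrite -addrA; congr (_ + _); rewrite addSn exprS.
    move: K2E; move: ((b / 2) ^+ (n + l)) ((b / 2) ^+ l) (2 ^+ l : R) => u v w H.
    rewrite (_ : 2 * w * u = w * u * (K2 * (2 - b)) / 2); last by rewrite H; field.
    by field.
  apply: (le_trans (lerD (le_trans H3 (lerD H4 (lexx _))) H2)).
  by rewrite [leRHS]mulrDr lerD2r addrC; exact: H1.
have [i li mi] : exists2 i, (l <= i)%N & (m <= 2 ^ i)%N.
  exists (l + m)%N; first exact: leq_addr.
  by rewrite ltnW// (leq_trans (ltn_expl m (ltnSn 1)))// leq_exp2l// leq_addl.
have := claim i li m mi.
have := mulr_ge0 (ltW k2) (D0 m) => H0 H.
rewrite (@le_trans _ _ (2 ^+ k * ((K1 + 2) * b ^+ l + K2 * 2 ^+ l * (b / 2) ^+ l)))//.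
  apply: le_trans (le_trans H _); first by rewrite lerDl.
  have K20 : 0 <= K2 by have := K2_ge; lra.
  have l0 : 0 <= 2 ^+ l :> R by rewrite exprn_ge0.
  rewrite ler_pM2l// lerD2l ler_wpM2l ?(mulr_ge0 K20 l0)//.
  by rewrite gerBl exprn_ge0// divr_ge0// ltW.
rewrite exprMn exprVn (_ : K2 * _ * _ = K2 * b ^+ l); last first.
  by rewrite -mulrA (mulrCA (2 ^+ l)) divff ?mulr1// expf_neq0.
by rewrite -mulrDl [leRHS]mulrAC mulrC.
Qed.

End KernelBits.
End Kernel.

(** * Subadditivity of powers and geometric sums *)

Section Sums.
Context {R : realType}.

Lemma powR_subadd (p u v : R) : 0 < p -> p <= 1 -> 0 <= u -> 0 <= v ->
  (u + v) `^ p <= u `^ p + v `^ p.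
Proof.
move=> p0 p1 u0 v0; have [/eqP|s0] := eqVneq (u + v) 0.
  rewrite paddr_eq0// => /andP[/eqP -> /eqP ->].
  by rewrite addr0 powR0 ?gt_eqF// addr0.
have {}s0 : 0 < u + v by rewrite lt_neqAle eq_sym s0 addr_ge0.
(* A number of [0, 1] is at most its p-th power; this is applied to the shares of [u] and [v] in
   their sum. *)
have key w : 0 <= w -> w <= u + v -> (u + v) `^ p * (w / (u + v)) <= w `^ p.
  rewrite le_eqVlt => /predU1P[<- _|w0 ws].
    by rewrite mul0r mulr0 powR_ge0.
  rewrite -[in leRHS](divfK (lt0r_neq0 s0) w) mulrC.
  rewrite powRM ?divr_ge0 ?(ltW w0) ?(ltW s0)// ler_pM2r ?powR_gt0//.
  by apply: ger1_powR => //; rewrite divr_gt0// ler_pdivrMr// mul1r.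
apply: le_trans (lerD (key u u0 _) (key v v0 _)); rewrite ?lerDl ?lerDr//.
by rewrite -mulrDr -mulrDl divff ?mulr1// lt0r_neq0.
Qed.

Lemma powR_sum_subadd (p : R) I (r : seq I) (P : pred I) (F : I -> R) :
  0 < p -> p <= 1 -> (forall i, 0 <= F i) ->
  (\sum_(i <- r | P i) F i) `^ p <= \sum_(i <- r | P i) F i `^ p.
Proof.
move=> p0 p1 F0; elim: r => [|i r IH].
  by rewrite !big_nil powR0// gt_eqF.
rewrite !big_cons; case: ifP => // _.
rewrite (le_trans (powR_subadd p0 p1 (F0 i) _)) ?sumr_ge0//.
by rewrite lerD2l.
Qed.

Lemma ler_sum_term (F : nat -> R) m n j : (forall i, 0 <= F i) ->
  (m <= j < n)%N -> F j <= \sum_(m <= i < n) F i.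
Proof.
move=> F0 mjn; rewrite (bigD1_seq j) ?mem_index_iota ?iota_uniq//=.
by rewrite lerDl sumr_ge0.
Qed.

Lemma geom_sum_le (r : R) m n : 0 < r -> r < 1 ->
  \sum_(m <= l < n) r ^+ l <= r ^+ m / (1 - r).
Proof.
move=> r0 r1; have d0 : 0 < 1 - r by rewrite subr_gt0.
have [mn|/ltnW nm] := leqP m n; last first.
  by rewrite big_geq// divr_ge0 ?exprn_ge0 ?(ltW d0) ?(ltW r0).
suff -> : \sum_(m <= l < n) r ^+ l = (r ^+ m - r ^+ n) / (1 - r).
  by rewrite ler_pM2r ?invr_gt0// gerBl exprn_ge0// (ltW r0).
rewrite -(subnKC mn); elim: (n - m)%N => [|k IH].
  by rewrite addn0 big_geq// subrr mul0r.
rewrite addnS big_nat_recr ?leq_addr//= IH exprS.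
by field; rewrite gt_eqF.
Qed.

Lemma geom_sum_ge (r : R) n : 1 < r ->
  \sum_(k < n) r ^+ k <= r ^+ n / (r - 1).
Proof.
move=> r1; have d0 : 0 < r - 1 by rewrite subr_gt0.
suff -> : \sum_(k < n) r ^+ k = (r ^+ n - 1) / (r - 1).
  by rewrite ler_pM2r ?invr_gt0// gerBl.
elim: n => [|k IH]; first by rewrite big_ord0 expr0 subrr mul0r.
by rewrite big_ord_recr/= IH exprS; field; rewrite gt_eqF.
Qed.

End Sums.

(** * Runs of zero bits and their measures *)

Section ZeroRuns.
Context {R : realType}.
Implicit Types (h : dyadic_group -> R) (x y : dyadic_group).

(** A real-valued indicator: it multiplies inside averages, factors over adjacent ranges and equals
    its own p-th power. *)
Definition zero_run s l x : R := \prod_(s <= t < l) (~~ x t)%:R.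

Lemma zero_runP s l x :
  reflect (forall t, (s <= t < l)%N -> x t = false) (zero_run s l x == 1).
Proof.
apply: (iffP eqP) => [x1 t stl|xs]; last first.
  by rewrite /zero_run big_nat_cond big1// => t /andP[/xs -> _].
apply: contraPF x1 => xt; rewrite /zero_run.
rewrite (bigD1_seq t) ?mem_index_iota ?iota_uniq//= xt mul0r.
by apply/eqP; rewrite eq_sym oner_neq0.
Qed.

Lemma zero_run01 s l x : zero_run s l x = 0 \/ zero_run s l x = 1.
Proof.
rewrite /zero_run; elim/big_ind : _ => [|u v [->|->] [->|->]|t _].
- by right.
- by left; rewrite mul0r.
- by left; rewrite mul0r.
- by left; rewrite mulr0.
- by right; rewrite mulr1.
- by case: (x t); [left|right].
Qed.

Lemma zero_run_ge0 s l x : 0 <= zero_run s l x.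
Proof. by case: (zero_run01 s l x) => ->. Qed.

Lemma powR_zero_run p s l x : p != 0 -> zero_run s l x `^ p = zero_run s l x.
Proof. by move=> p0; case: (zero_run01 s l x) => ->; rewrite ?powR0 ?powR1. Qed.

Lemma determined_zero_run s l : determined l (zero_run s l).
Proof.
move=> x y xy; rewrite /zero_run big_nat_cond [RHS]big_nat_cond.
by apply: eq_bigr => t /andP[/andP[_ tl] _]; rewrite xy.
Qed.

Lemma zero_run_cat s m l x : (s <= m)%N -> (m <= l)%N ->
  zero_run s l x = zero_run s m x * zero_run m l x.
Proof. by move=> sm ml; rewrite /zero_run (big_cat_nat sm ml). Qed.

Lemma avg_zero_run s l c x : (s <= l)%N -> (l <= s + c)%N ->
  avg s c (zero_run s l) x = 2^-1 ^+ (l - s).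
Proof.
elim: c s x => [|c IH] s x sl lsc.
  have -> : l = s by move: lsc; rewrite addn0 => ?; apply/eqP; rewrite eqn_leq sl andbT.
  by rewrite /= subnn /zero_run big_geq.
move: sl; rewrite leq_eqVlt => /predU1P[sl|sl].
  rewrite -sl subnn (@eq_avg _ _ _ _ (fun=> 1)) ?avg_cst// => y.
  by rewrite /zero_run big_geq.
rewrite [LHS]/=.
have H b y : y s = b ->
    avg s.+1 c (zero_run s l) y = (~~ b)%:R * 2^-1 ^+ (l - s.+1).
  move=> ys; rewrite -(IH s.+1 y)//; last by rewrite addSnnS.
  rewrite -avgZ; apply: eq_avg_cylinder => z yz.
  by rewrite /zero_run big_ltn// yz// ys.
rewrite (H false) ?(H true)/set_bit ?eqxx//.
by rewrite mul0r addr0 mul1r mulrC -exprS -subSn.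
Qed.

Lemma avg_zero_run_split s m l c x : (s <= m)%N -> (m <= l)%N ->
  (l <= m + c)%N ->
  avg m c (zero_run s l) x = zero_run s m x * 2^-1 ^+ (l - m).
Proof.
move=> sm ml lmc; rewrite -(avg_zero_run x ml lmc) -avg_pull; last first.
  exact: determined_zero_run.
by apply: eq_avg => y; exact: zero_run_cat.
Qed.

Lemma first_bit_sum i x :
  zero_run 0 i x + \sum_(k < i) zero_run 0 k x * (x k)%:R = 1.
Proof.
elim: i => [|i IH]; first by rewrite big_ord0 addr0 /zero_run big_geq.
rewrite big_ord_recr/= /zero_run big_nat_recr//= -/(zero_run 0 i x).
rewrite addrCA -mulrDr.
have -> : (~~ x i)%:R + (x i)%:R = 1 :> R.
  by case: (x i); rewrite /= ?addr0 ?add0r.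
by rewrite mulr1 addrC.
Qed.

Lemma avg_first_bit c i h x : avg 0 c h x =
  avg 0 c (fun y => zero_run 0 i y * h y) x +
  \sum_(k < i) avg 0 c (fun y => zero_run 0 k y * (y k)%:R * h y) x.
Proof.
rewrite -avg_sum -avgD; apply: eq_avg => y.
by rewrite -mulr_suml -mulrDl first_bit_sum mul1r.
Qed.

(** Bit [k] stays free, so only l - 1 bits are prescribed; hence the factor 2. *)
Lemma avg_two_runs k l c x : (k < l)%N -> (l <= c)%N ->
  avg 0 c (fun y => zero_run 0 k y * zero_run k.+1 l y) x =
  2 * 2^-1 ^+ l.
Proof.
move=> kl lc; rewrite -(subnKC (leq_trans kl lc)) avg_cat add0n.
rewrite (@eq_avg _ _ _ _ (fun y => 2^-1 ^+ (l - k.+1) * zero_run 0 k y)).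
  rewrite avgZ avg_zero_run ?add0n// subn0 -exprD.
  by rewrite -{2}(subnK kl) addnS exprS mulrA divff// mul1r.
move=> y; rewrite avg_pull; last first.
  by apply: determinedW (@determined_zero_run 0 k).
by rewrite avg_zero_run ?subnKC// ?(leq_trans kl lc)// mulrC.
Qed.

End ZeroRuns.

(** * Averages of the kernel and of powers of its conditional expectations *)

Section KernelAverages.
Context {R : realType}.
Variable a : R.
Hypotheses (a0 : 0 < a) (a1 : a < 1).
Implicit Types x y : dyadic_group.
Local Notation b := (2 `^ a).
Local Notation kernel := (cesaro_kernel a).
Local Notation K := (kernel_cst a).

Let b1 : 1 < b := two_powR_gt1 a0.
Let b2 : b < 2 := two_powR_lt2 a1.
Let b0 : 0 < b := lt_trans ltr01 b1.
Let K0 : 0 < K := kernel_cst_gt0 a0 a1.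
Let h0 : 0 < b / 2. Proof. by rewrite divr_gt0. Qed.
Let h1 : b / 2 < 1. Proof. by rewrite ltr_pdivrMr// mul1r. Qed.

(** The term at the true second bit already suffices. The sum over all [l] removes the dependence on
    its position, so that averages can be taken term by term at the price of a geometric series. *)
Lemma kernel_first_bit m i k y : (m <= 2 ^ i)%N -> (k < i)%N ->
  zero_run 0 k y = 1 :> R -> y k = true ->
  `|kernel m y| <= K * 2 ^+ k * \sum_(k.+1 <= l < i.+1) b ^+ l * zero_run k.+1 l y.
Proof.
move=> mi ki /eqP/zero_runP yk0 yk.
(* Truncating the search at [i] covers points without a second bit below [i]; there the one-bit
   estimate gives the same bound. *)
pose P t := (k < t)%N && ((t == i) || y t).
have exP : exists t, P t by exists i; rewrite /P ki eqxx.
case: (ex_minnP exP) => l /andP[kl yl] lmin.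
have li : (l <= i)%N by apply: lmin; rewrite /P ki eqxx.
have ykl t : (k < t < l)%N -> y t = false.
  move=> /andP[kt tl]; apply: contraTF tl => yt.
  by rewrite -leqNgt lmin// /P kt yt orbT.
have B : `|kernel m y| <= K * 2 ^+ k * b ^+ l.
  case/orP : yl => [/eqP ->|yl]; last exact: kernel_two_bits.
  exact: kernel_one_bit (ltnW ki) mi.
apply: (le_trans B); rewrite ler_wpM2l ?mulr_ge0 ?exprn_ge0 ?(ltW K0)//.
have <- : b ^+ l * zero_run k.+1 l y = b ^+ l.
  by have /zero_runP/eqP -> := ykl; rewrite mulr1.
apply: (@ler_sum_term _ (fun l => b ^+ l * zero_run k.+1 l y)).
  by move=> t; rewrite mulr_ge0 ?zero_run_ge0 ?exprn_ge0 ?(ltW b0).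
by rewrite kl ltnS.
Qed.

Lemma avg_run_sum k n c (w : nat -> R) (h : dyadic_group -> R) x :
  (n <= c)%N -> (forall l, 0 <= w l) -> (forall y, 0 <= h y) ->
  (forall y, zero_run 0 k y = 1 :> R -> y k = true ->
     h y <= \sum_(k.+1 <= l < n.+1) w l * zero_run k.+1 l y) ->
  avg 0 c (fun y => zero_run 0 k y * (y k)%:R * h y) x <=
  2 * \sum_(k.+1 <= l < n.+1) w l * 2^-1 ^+ l.
Proof.
move=> nc w0 hge hw.
rewrite (@le_trans _ _ (avg 0 c (fun y => \sum_(k.+1 <= l < n.+1)
    w l * (zero_run 0 k y * zero_run k.+1 l y)) x))//.
  apply: le_avg => y; rewrite (eq_bigr (fun l =>
    zero_run 0 k y * (w l * zero_run k.+1 l y))); last by move=> l _; ring.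
  rewrite -mulr_sumr -mulrA.
  have S0 : 0 <= \sum_(k.+1 <= l < n.+1) w l * zero_run k.+1 l y.
    by apply: sumr_ge0 => l _; rewrite mulr_ge0 ?zero_run_ge0.
  have [z0|z1] := @zero_run01 R 0 k y; first by rewrite z0 !mul0r.
  rewrite z1 !mul1r; case yk: (y k); last by rewrite mul0r.
  by rewrite mul1r hw.
rewrite avg_sum mulr_sumr big_nat [leRHS]big_nat; apply: ler_sum => l /andP[kl ln].
by rewrite avgZ avg_two_runs ?(leq_trans _ nc)//; lra.
Qed.

Definition kernel_L1_cst : R := K + K * (2 / (2 - b)) * (2 / (b - 1)).

Lemma avg_kernel m i c x : (m <= 2 ^ i)%N -> (i <= c)%N ->
  avg 0 c (fun y => `|kernel m y|) x <= kernel_L1_cst * b ^+ i.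
Proof.
move=> mi ic; rewrite (avg_first_bit _ i) /kernel_L1_cst mulrDl; apply: lerD.
  rewrite (@le_trans _ _
      (avg 0 c (fun y => (K * 2 ^+ i * b ^+ i) * zero_run 0 i y) x))//.
    apply: le_avg => y; rewrite mulrC ler_wpM2r ?zero_run_ge0//.
    rewrite (le_trans (kernel_bound _ _ _ mi))//.
    rewrite !ler_wpM2r ?exprn_ge0 ?(ltW b0)// /kernel_cst.
    rewrite addrAC lerDr addr_ge0// divr_ge0// subr_ge0 ltW//.
  rewrite avgZ avg_zero_run// subn0 mulrAC -[K * _ * _]mulrA -exprMn divff//.
  by rewrite expr1n mulr1.
rewrite (@le_trans _ _ (\sum_(k < i) K * (2 / (2 - b)) * b * b ^+ k))//.
  apply: ler_sum => k _.
  apply: (le_trans (@avg_run_sum k i c (fun l => K * 2 ^+ k * b ^+ l) _ x ic _ _ _)).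
  - by move=> l; rewrite !mulr_ge0 ?exprn_ge0 ?(ltW K0) ?(ltW b0).
  - by move=> y; exact: normr_ge0.
  - move=> y yk0 yk; rewrite (le_trans (kernel_first_bit mi (ltn_ord k) yk0 yk))//.
    by rewrite mulr_sumr le_eqVlt; apply/orP; left; apply/eqP/eq_bigr => l _; rewrite mulrA.
  under eq_bigr do rewrite -mulrA -exprMn.
  rewrite -mulr_sumr mulrA.
  apply: (le_trans (ler_wpM2l _ (geom_sum_le k.+1 i.+1 h0 h1))).
    by rewrite !mulr_ge0 ?exprn_ge0 ?(ltW K0).
  rewrite !exprMn !exprS exprVn le_eqVlt; apply/orP; left; apply/eqP.
  by field; rewrite subr_eq0 gt_eqF// expf_neq0.
rewrite -mulr_sumr -!mulrA !ler_pM2l ?invr_gt0 ?subr_gt0//.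
rewrite ler_pM ?(ltW b0) ?(ltW b2)//.
  by apply: sumr_ge0 => l _; rewrite exprn_ge0 ?(ltW b0).
by rewrite mulrC; exact: geom_sum_ge.
Qed.

Definition kernel_tail_cst : R := K * (1 + 2 / (2 - b)).

(** Terms with l <= M do not depend on the averaged bits. Each later term gains 2^(M-l), so the tail
    is geometric and is absorbed by the term l = M; this is the summand 2 / (2 - b) of the
    constant. *)
Lemma avg_tail_kernel m i k M c x : (m <= 2 ^ i)%N -> (k < M)%N ->
  (M <= i)%N -> (i <= M + c)%N -> zero_run 0 k x = 1 :> R -> x k = true ->
  avg M c (fun y => `|kernel m y|) x <=
  kernel_tail_cst * 2 ^+ k *
    \sum_(k.+1 <= l < M.+1) b ^+ l * zero_run k.+1 l x.
Proof.
move=> mi kM Mi iMc xk0 xk.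
rewrite (@le_trans _ _ (avg M c (fun y => K * 2 ^+ k *
    \sum_(k.+1 <= l < i.+1) b ^+ l * zero_run k.+1 l y) x))//.
  apply: le_avg_cylinder => y xy; apply: kernel_first_bit => //.
  - exact: leq_trans Mi.
  - by rewrite -xk0; apply: determined_zero_run; exact: cylinder_sub (ltnW kM) _ xy.
  - by rewrite xy.
rewrite avgZ avg_sum (big_cat_nat (n := M.+1))//=; last exact: leqW.
rewrite /kernel_tail_cst; set S := (X in _ <= _ * X).
rewrite [leRHS](_ : _ = K * 2 ^+ k * (S + 2 / (2 - b) * S)); last by ring.
rewrite ler_pM2l; last by rewrite mulr_gt0// exprn_gt0.
apply: lerD.
  rewrite /S big_nat [leRHS]big_nat; apply: ler_sum => l /andP[_ lM].
  rewrite avgZ avg_id//.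
  by apply: determinedW (@determined_zero_run R k.+1 l).
rewrite (@le_trans _ _ (2 / (2 - b) * (b ^+ M * zero_run k.+1 M x)))//.
  rewrite big_nat (eq_bigr (fun l => 2 ^+ M * zero_run k.+1 M x * (b / 2) ^+ l)).
    rewrite -big_nat -mulr_sumr.
    apply: (le_trans (ler_wpM2l _ (geom_sum_le M.+1 i.+1 h0 h1))).
      by rewrite mulr_ge0 ?zero_run_ge0 ?exprn_ge0.
    rewrite [X in X <= _](_ : _ = b / (2 - b) * (b ^+ M * zero_run k.+1 M x)).
      rewrite ler_wpM2r ?mulr_ge0 ?zero_run_ge0 ?exprn_ge0 ?(ltW b0)//.
      by rewrite ler_pM2r ?invr_gt0 ?subr_gt0// ltW.
    rewrite exprMn !exprS exprVn; field.
    by rewrite subr_eq0 gt_eqF// expf_neq0.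
  move=> l /andP[Ml li]; rewrite avgZ avg_zero_run_split//; last 2 first.
  - exact: ltnW.
  - by rewrite (leq_trans _ iMc).
  rewrite -{1 3}(subnKC (ltnW Ml)) exprMn !exprVn !exprD; field.
  by rewrite !expf_neq0.
rewrite ler_pM2l ?divr_gt0 ?subr_gt0//.
apply: (@ler_sum_term _ (fun l => b ^+ l * zero_run k.+1 l x)).
  by move=> l; rewrite mulr_ge0 ?zero_run_ge0 ?exprn_ge0 ?(ltW b0).
by rewrite kM ltnSn.
Qed.

Section Power.
Variable p : R.
Hypotheses (p0 : 0 < p) (p1 : p <= 1) (bp : (2 * b) `^ p = 2).

Lemma powR_expn (u : R) l : 0 <= u -> (u ^+ l) `^ p = (u `^ p) ^+ l.
Proof. by move=> u0; rewrite -!powR_mulrn ?powR_ge0// powRAC. Qed.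

Let r : R := (2 `^ p)^-1.
Let r0 : 0 < r. Proof. by rewrite invr_gt0 powR_gt0. Qed.
Let r1 : r < 1.
Proof. by rewrite invf_lt1 ?posrE ?powR_gt0// two_powR_gt1. Qed.
Let br : b `^ p = 2 * r.
Proof.
apply: (@mulfI _ (2 `^ p)); first by rewrite gt_eqF ?powR_gt0.
by rewrite -powRM ?(ltW b0)// bp mulrCA /r divff ?mulr1// gt_eqF ?powR_gt0.
Qed.

Definition kernel_power_cst : R :=
  kernel_L1_cst `^ p + kernel_tail_cst `^ p * (2 * (r / (1 - r))).

Lemma kernel_L1_cst_ge0 : 0 <= kernel_L1_cst.
Proof.
rewrite /kernel_L1_cst addr_ge0 ?(ltW K0)// mulr_ge0 ?divr_ge0 ?subr_ge0 ?(ltW b1)//.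
by rewrite mulr_ge0 ?(ltW K0)// divr_ge0 ?subr_ge0 ?(ltW b2).
Qed.

Lemma kernel_tail_cst_ge0 : 0 <= kernel_tail_cst.
Proof.
by rewrite mulr_ge0 ?(ltW K0)// addr_ge0// divr_ge0 ?subr_ge0 ?(ltW b2).
Qed.

Lemma avg_kernel_powR m i M c x : (m <= 2 ^ i)%N -> (M <= i)%N ->
  (i <= M + c)%N ->
  avg 0 (M + c) (fun y => avg M c (fun z => `|kernel m z|) y `^ p) x <=
  kernel_power_cst * (M%:R + 2^-1 ^+ M * (2 ^+ M * b ^+ i) `^ p).
Proof.
move=> mi Mi iMc; pose H y := avg M c (fun z => `|kernel m z|) y.
have H0 y : 0 <= H y by apply: avg_ge0 => z; exact: normr_ge0.
(* On the cylinder of M zero bits there is no decay; a single value is bounded by 2^M times the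
   whole average. *)
have H1 y : H y <= kernel_L1_cst * (2 ^+ M * b ^+ i).
  apply: (le_trans (avg_ge_cylinder 0 M y H0)).
  rewrite mulrCA ler_pM2l ?exprn_gt0// /H.
  by have := avg_kernel y mi iMc; rewrite avg_cat add0n.
have L0 := kernel_L1_cst_ge0; have T0 := kernel_tail_cst_ge0.
have B0 : 0 <= (2 ^+ M * b ^+ i : R) by rewrite mulr_ge0 ?exprn_ge0 ?(ltW b0).
rewrite (avg_first_bit _ M) mulrDr addrC; apply: lerD; last first.
  rewrite (@le_trans _ _ (kernel_L1_cst `^ p * (2^-1 ^+ M * (2 ^+ M * b ^+ i) `^ p)))//.
    have ZM : avg 0 (M + c) (zero_run 0 M) x = 2^-1 ^+ M :> R.
      by rewrite avg_zero_run ?subn0// add0n leq_addr.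
    rewrite mulrCA -powRM// mulrC -ZM -avgZ; apply: le_avg => y.
    rewrite mulrC ler_wpM2r ?zero_run_ge0//.
    by apply: ge0_ler_powR; rewrite ?nnegrE ?(ltW p0)// mulr_ge0.
  rewrite ler_wpM2r ?mulr_ge0 ?exprn_ge0 ?powR_ge0 ?invr_ge0// lerDl.
  by rewrite mulr_ge0 ?powR_ge0// mulr_ge0// divr_ge0 ?(ltW r0)// subr_ge0 ltW.
(* The summand does not depend on [k]: since b^p / 2 = r = 2^-p, the sum of r^l over l > k exactly
   compensates 2^(k p). *)
rewrite (@le_trans _ _ (\sum_(k < M) (kernel_tail_cst `^ p * (2 * (r / (1 - r))))))//.
  apply: ler_sum => k _.
  apply: (le_trans (@avg_run_sum k M (M + c)
    (fun l => (kernel_tail_cst * 2 ^+ k) `^ p * (b ^+ l) `^ p) (fun y => H y `^ p) x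
    (leq_addr _ _) _ _ _)).
  - by move=> l; rewrite mulr_ge0 ?powR_ge0.
  - by move=> y; exact: powR_ge0.
  - move=> y yk0 yk.
    have Hy := avg_tail_kernel mi (ltn_ord k) Mi iMc yk0 yk.
    have F0 l : 0 <= b ^+ l * zero_run k.+1 l y.
      by rewrite mulr_ge0 ?zero_run_ge0 ?exprn_ge0 ?(ltW b0).
    have S0 : 0 <= \sum_(k.+1 <= l < M.+1) b ^+ l * zero_run k.+1 l y.
      by apply: sumr_ge0 => l _; exact: F0.
    have TK : 0 <= kernel_tail_cst * 2 ^+ k by rewrite mulr_ge0 ?exprn_ge0.
    have : H y `^ p <= (kernel_tail_cst * 2 ^+ k *
        \sum_(k.+1 <= l < M.+1) b ^+ l * zero_run k.+1 l y) `^ p.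
      by apply: ge0_ler_powR Hy; rewrite ?nnegrE ?(ltW p0)// mulr_ge0.
    move=> /le_trans; apply; rewrite powRM//.
    under [leRHS]eq_bigr do rewrite -mulrA.
    rewrite -mulr_sumr ler_wpM2l ?powR_ge0//.
    apply: (le_trans (powR_sum_subadd _ _ p0 p1 F0)).
    rewrite le_eqVlt; apply/orP; left; apply/eqP/eq_bigr => l _.
    by rewrite powRM ?zero_run_ge0 ?exprn_ge0 ?(ltW b0)// powR_zero_run ?gt_eqF.
  rewrite (eq_bigr (fun l => (kernel_tail_cst * 2 ^+ k) `^ p * r ^+ l)); last first.
    move=> l _; rewrite powR_expn ?(ltW b0)// br -mulrA -exprMn.
    by rewrite (_ : 2 * r / 2 = r)// mulrAC divff// mul1r.
  rewrite -mulr_sumr powRM ?exprn_ge0// powR_expn// mulrCA -!mulrA.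
  rewrite ler_wpM2l ?powR_ge0// mulrCA ler_pM2l//.
  apply: (le_trans (ler_wpM2l _ (geom_sum_le k.+1 M.+1 r0 r1))).
    by rewrite exprn_ge0 ?powR_ge0.
  rewrite [leLHS](_ : _ = (2 `^ p) ^+ k * r ^+ k * (r / (1 - r))); last first.
    by rewrite exprS; ring.
  by rewrite -exprMn divff ?expr1n ?mul1r// gt_eqF// powR_gt0.
rewrite sumr_const card_ord -[leLHS]mulr_natr ler_wpM2r// lerDr.
by rewrite powR_ge0.
Qed.

End Power.
End KernelAverages.

(** * Convolutions and maximal functions at a finite level *)

Section MaximalFunctions.
Context {R : realType}.
Variable N : nat.
Implicit Types (f g h : dyadic_group -> R) (x y t : dyadic_group).

Definition zero_point : dyadic_group := fun=> false.
Local Notation o := zero_point.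

Definition cexp k f := avg k (N - k) f.

Definition dconv f g x : R := avg 0 N (fun t => f t * g (dyadic_add x t)) o.

Definition maxfun f x : R := \big[Num.max/0]_(k < N.+1) `|cexp k f x|.

Lemma cexpD k f g x : cexp k (fun y => f y + g y) x = cexp k f x + cexp k g x.
Proof. exact: avgD. Qed.

Lemma cexpZ k c f x : cexp k (fun y => c * f y) x = c * cexp k f x.
Proof. exact: avgZ. Qed.

Lemma determined_cexp k f : determined N f -> determined k (cexp k f).
Proof. by move=> fN; apply: determined_avg fN; lia. Qed.

Lemma cexp_cexp m k f x : determined N f -> (m <= k)%N -> (k <= N)%N ->
  cexp m (cexp k f) x = cexp m f x.
Proof.
move=> fN mk kN; rewrite /cexp (_ : N - m = (k - m) + (N - k))%N; last by lia.
rewrite !avg_cat subnKC//; apply: eq_avg => y.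
by apply: avg_id; exact: determined_cexp.
Qed.

Lemma cexp_N f x : cexp N f x = f x.
Proof. by rewrite /cexp subnn. Qed.

Lemma avg_cexp k f x : (k <= N)%N -> avg 0 k (cexp k f) x = avg 0 N f x.
Proof. by move=> kN; rewrite /cexp -{2}(subnKC kN) avg_cat. Qed.

Lemma maxfun_ge0 f x : 0 <= maxfun f x.
Proof. by rewrite /maxfun; elim/big_ind : _ => // u v u0 v0; rewrite le_max u0. Qed.

Lemma cexp_le_maxfun k f x : (k <= N)%N -> `|cexp k f x| <= maxfun f x.
Proof.
by move=> kN; exact: (le_bigmax _ (fun k : 'I_N.+1 => `|cexp k f x|) (Ordinal (kN : (k < N.+1)%N))).
Qed.

Lemma maxfun_le f x B : 0 <= B -> (forall k, (k <= N)%N -> `|cexp k f x| <= B) ->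
  maxfun f x <= B.
Proof. by move=> B0 fB; apply: bigmax_le => // k _; rewrite fB// -ltnS. Qed.

Lemma maxfunD f g x :
  maxfun (fun y => f y + g y) x <= maxfun f x + maxfun g x.
Proof.
apply: maxfun_le => [|k kN]; first by rewrite addr_ge0 ?maxfun_ge0.
by rewrite cexpD (le_trans (ler_normD _ _))// lerD ?cexp_le_maxfun.
Qed.

Lemma maxfunZ c f x : maxfun (fun y => c * f y) x <= `|c| * maxfun f x.
Proof.
apply: maxfun_le => [|k kN]; first by rewrite mulr_ge0 ?maxfun_ge0.
by rewrite cexpZ normrM ler_wpM2l ?cexp_le_maxfun.
Qed.

Lemma eq_maxfun f g x : f =1 g -> maxfun f x = maxfun g x.
Proof. by move=> /funext ->. Qed.

Lemma determined_maxfun f : determined N f -> determined N (maxfun f).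
Proof.
move=> fN x y xy; rewrite /maxfun; apply: eq_bigr => k _; congr `|_|.
by apply: determined_cexp (cylinder_sub _ xy) => //; rewrite -ltnS.
Qed.

Lemma cexp_dconv k f g x : (k <= N)%N ->
  cexp k (dconv f g) x = dconv f (cexp k g) x.
Proof.
move=> kN; rewrite /cexp /dconv avg_swap; apply: eq_avg => t.
by rewrite avgZ avg_translateC.
Qed.

(** A translate of [g] is still constant on cylinders of length M, so it comes out of the
    conditional expectation of the product, leaving that of [f]. *)
Lemma dconv_eq0 M f g x : (M <= N)%N -> (forall y, cexp M f y = 0) ->
  determined M g -> dconv f g x = 0.
Proof.
move=> MN f0 gM; rewrite /dconv -(avg_cexp _ _ MN) -[RHS](avg_cst 0 M 0 o).
apply: eq_avg => t; rewrite /cexp.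
rewrite (@eq_avg _ _ _ _ (fun y => g (dyadic_add x y) * f y)); last first.
  by move=> y; rewrite mulrC.
rewrite avg_pull; last exact: determined_translate.
by have := f0 t; rewrite /cexp => ->; rewrite mulr0.
Qed.

Lemma normr_dconv f g h x (lam : R) : (forall t, `|f t| <= lam * h t) ->
  `|dconv f g x| <= lam * dconv h (fun y => `|g y|) x.
Proof.
move=> fh; rewrite /dconv -avgZ (le_trans (normr_avg _ _ _ _))//.
by apply: le_avg => t; rewrite normrM mulrA ler_wpM2r.
Qed.

Lemma dconv_determined M h g x : (M <= N)%N -> determined M h ->
  dconv h g x = avg 0 M (fun t => h t * cexp M g (dyadic_add x t)) o.
Proof.
move=> MN hM; rewrite /dconv -(avg_cexp _ _ MN); apply: eq_avg => t.
by rewrite /cexp avg_pull// avg_translate.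
Qed.

(** Each averaged bit costs 2 / 2^p, because ((u + v) / 2)^p <= (u^p + v^p) / 2^p by
    subadditivity. *)
Lemma avg_powR (p : R) a c f x : 0 < p -> p <= 1 -> (forall y, 0 <= f y) ->
  avg a c f x `^ p <= (2 / 2 `^ p) ^+ c * avg a c (fun y => f y `^ p) x.
Proof.
move=> p0 p1 f0; elim: c a x => [|c IH] a x /=; first by rewrite mul1r.
have c0 : 0 < 2 `^ p :> R by rewrite powR_gt0.
have A0 y : 0 <= avg a.+1 c f y by exact: avg_ge0.
rewrite powRM ?addr_ge0 ?invr_ge0//.
apply: (le_trans (ler_wpM2r _ (le_trans
  (powR_subadd p0 p1 (A0 _) (A0 _)) (lerD (IH _ _) (IH _ _))))).
  by rewrite powR_ge0.
have -> : 2^-1 `^ p = (2 `^ p)^-1 :> R.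
  by rewrite -(@powR_inv1 _ 2)// powRAC powR_inv1 ?powR_ge0.
rewrite exprS.
by rewrite le_eqVlt; apply/orP; left; apply/eqP; field; rewrite gt_eqF.
Qed.

Lemma maxfun_dconv_bounded f g x (lam L : R) : determined N g ->
  (forall t, `|f t| <= lam) -> avg 0 N (fun y => `|g y|) x <= L ->
  maxfun (dconv f g) x <= lam * L.
Proof.
move=> gN flam gL; have lam0 : 0 <= lam by exact: le_trans (flam o).
have gN' : determined N (fun y => `|g y|) by move=> u v /gN ->.
have L0 : 0 <= L.
  by apply: le_trans gL; apply: avg_ge0 => y; exact: normr_ge0.
apply: maxfun_le => [|k kN]; first by rewrite mulr_ge0.
rewrite cexp_dconv// (le_trans (@normr_dconv _ _ (fun=> 1) _ lam _))//.
  by move=> t; rewrite mulr1.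
rewrite ler_wpM2l// (le_trans _ gL)// /dconv.
under eq_avg do rewrite mul1r.
rewrite (@avg_translate _ _ _ (fun y => `|cexp k g y|)).
apply: (@le_trans _ _ (avg 0 N (cexp k (fun y => `|g y|)) (dyadic_add x o))).
  by apply: le_avg => y; exact: normr_avg.
have := @cexp_cexp 0 k (fun y => `|g y|) (dyadic_add x o) gN' isT kN.
rewrite /cexp subn0 => ->.
by rewrite -(@determined_avg _ N 0 N (fun y => `|g y|) _ gN' x (dyadic_add x o)).
Qed.

(** Conditional expectations fall on [g]. Up to level M they give 0 by [dconv_eq0]; above M,
    averaging against the level-M function [h] reduces the expectation of the absolute value to
    level M, uniformly in k. *)
Lemma maxfun_dconv_atom M f g h x (lam : R) : (M <= N)%N -> determined N g ->
  determined M h -> 0 <= lam -> (forall t, 0 <= h t) ->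
  (forall t, `|f t| <= lam * h t) -> (forall y, cexp M f y = 0) ->
  maxfun (dconv f g) x <=
  lam * avg 0 M (fun t => h t * cexp M (fun y => `|g y|) (dyadic_add x t)) o.
Proof.
move=> MN gN hM lam0 h0 fh f0.
have gN' : determined N (fun y => `|g y|) by move=> u v /gN ->.
have G0 y : 0 <= cexp M (fun y => `|g y|) y.
  by apply: avg_ge0 => z; exact: normr_ge0.
apply: maxfun_le => [|k kN].
  by rewrite mulr_ge0// avg_ge0// => t; rewrite mulr_ge0.
rewrite cexp_dconv//; have [kM|Mk] := leqP k M.
  rewrite (@dconv_eq0 M)//.
    by rewrite normr0 mulr_ge0// avg_ge0// => t; rewrite mulr_ge0.
  by apply: determinedW kM _; exact: determined_cexp.
apply: (le_trans (normr_dconv _ _ fh)); rewrite ler_wpM2l//.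
rewrite (dconv_determined _ _ MN hM); apply: le_avg => t.
rewrite ler_wpM2l//.
rewrite -(cexp_cexp _ gN' (ltnW Mk) kN); apply: le_avg => y.
exact: normr_avg.
Qed.

End MaximalFunctions.

(** * The Hardy quasi-norm at a finite level *)

Section HardyQuasinorm.
Context {R : realType}.
Variables (N : nat) (p : R).
Hypotheses (p0 : 0 < p) (p1 : p <= 1).
Implicit Types (f g h : dyadic_group -> R) (x y t : dyadic_group).
Local Notation o := zero_point.

(* The p-th power of the Hardy quasi-norm at the finite level [N]. *)
Definition hp f : R := avg 0 N (fun x => maxfun N f x `^ p) o.

Lemma hp_ge0 f : 0 <= hp f.
Proof. by apply: avg_ge0 => x; exact: powR_ge0. Qed.

Lemma le_powR_p (u v : R) : 0 <= u -> u <= v -> u `^ p <= v `^ p.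
Proof.
move=> u0 uv; have v0 := le_trans u0 uv.
by apply: ge0_ler_powR uv; rewrite ?nnegrE ?(ltW p0).
Qed.

Lemma hpD f g : hp (fun y => f y + g y) <= hp f + hp g.
Proof.
rewrite /hp -avgD; apply: le_avg => x.
apply: le_trans (powR_subadd p0 p1 (maxfun_ge0 _ _ _) (maxfun_ge0 _ _ _)).
by apply: le_powR_p; [exact: maxfun_ge0|exact: maxfunD].
Qed.

Lemma hp_le f (B : R) : 0 <= B -> (forall x, maxfun N f x <= B) ->
  hp f <= B `^ p.
Proof.
move=> B0 fB; rewrite -(avg_cst 0 N (B `^ p) o); apply: le_avg => x.
by apply: le_powR_p; rewrite ?maxfun_ge0.
Qed.

Lemma hp0 f : (forall x, f x = 0) -> hp f = 0.
Proof.
move=> f0; apply/eqP; rewrite eq_le hp_ge0 andbT.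
rewrite (le_trans (@hp_le f 0 _ _))//; last by rewrite powR0 ?gt_eqF.
move=> x; apply: maxfun_le => // k kN.
by rewrite /cexp (eq_avg _ _ _ f0) avg_cst normr0.
Qed.

Lemma hpZ c f : hp (fun y => c * f y) <= `|c| `^ p * hp f.
Proof.
rewrite /hp -avgZ; apply: le_avg => x; rewrite -powRM ?maxfun_ge0//.
by apply: le_powR_p; [exact: maxfun_ge0|exact: maxfunZ].
Qed.

(* [(2 / 2 ^ p) ^ M] comes from the concavity loss in passing the power [p] inside
   an average over the [2 ^ M] cylinders of length [M]; no splitting of the
   support of [h] into single cylinders is needed. *)
Lemma hp_dconv_atom M f g h (lam C : R) : (M <= N)%N -> determined N g ->
  determined M h -> 0 <= lam -> (forall t, h t = 0 \/ h t = 1) ->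
  (forall t, `|f t| <= lam * h t) -> (forall y, cexp N M f y = 0) ->
  (forall x, avg 0 N (fun y => cexp N M (fun z => `|g z|) y `^ p) x <= C) ->
  hp (dconv N f g) <= lam `^ p * (2 / 2 `^ p) ^+ M * avg 0 M h o * C.
Proof.
move=> MN gN hM lam0 h01 fh f0 gC.
have h0 t : 0 <= h t by case: (h01 t) => ->.
pose G := cexp N M (fun z => `|g z|).
have G0 y : 0 <= G y by apply: avg_ge0 => z; exact: normr_ge0.
rewrite (@le_trans _ _ (avg 0 N (fun x => lam `^ p * (2 / 2 `^ p) ^+ M *
   avg 0 M (fun t => h t * G (dyadic_add x t) `^ p) o) o))//.
  apply: le_avg => x.
  have A0 : 0 <= avg 0 M (fun t => h t * G (dyadic_add x t)) o.
    by apply: avg_ge0 => t; rewrite mulr_ge0.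
  apply: (le_trans (le_powR_p _ (maxfun_dconv_atom x MN gN hM lam0 h0 fh f0))).
    exact: maxfun_ge0.
  rewrite powRM// -mulrA ler_wpM2l ?powR_ge0//.
  apply: (le_trans (avg_powR _ _ _ p0 p1 _)).
    by move=> t; rewrite mulr_ge0.
  rewrite ler_wpM2l ?exprn_ge0 ?divr_ge0 ?powR_ge0//.
  apply: le_avg => t; rewrite powRM// ler_wpM2r ?powR_ge0//.
  by case: (h01 t) => ->; rewrite ?powR1// powR0// gt_eqF.
rewrite avgZ -[leRHS]mulrA ler_wpM2l ?mulr_ge0 ?exprn_ge0 ?divr_ge0 ?powR_ge0//.
rewrite avg_swap mulrC -avgZ; apply: le_avg => t.
by rewrite avgZ mulrC ler_wpM2r// (@avg_translateC _ _ _ (fun y => G y `^ p)).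
Qed.

End HardyQuasinorm.

(** * Predictable stopping and the pieces of the atomic decomposition *)

Section Stopping.
Context {R : realType}.
Variables (N : nat) (f : dyadic_group -> R).
Hypothesis fN : determined N f.
Implicit Types (x y : dyadic_group) (lam : R).
Local Notation F k := (cexp N k f).
Local Notation o := zero_point.

(* A child of one of the cylinders of length less than [n] around [x] carries a
   value above [lam]; testing children makes the stopping time predictable. *)
Definition stopped lam n x : bool :=
  has (fun u => (lam < `|F u.+1 (set_bit u false x)|) ||
                (lam < `|F u.+1 (set_bit u true x)|)) (iota 0 n).

(* The stopping time takes the value [i]. *)
Definition first_stop lam i x : bool := stopped lam i.+1 x && ~~ stopped lam i x.

(** The stopped martingale as a transform: the increment from n to n + 1 is kept exactly when the
    stopping time exceeds n. *)
Definition stopped_value lam k x : R :=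
  F 0 x + \sum_(n < k) (~~ stopped lam n.+1 x)%:R * (F n.+1 x - F n x).

Lemma stoppedS lam n x : stopped lam n.+1 x = stopped lam n x ||
  ((lam < `|F n.+1 (set_bit n false x)|) || (lam < `|F n.+1 (set_bit n true x)|)).
Proof. by rewrite /stopped -[X in iota 0 X]addn1 iotaD has_cat/= orbF add0n. Qed.

Lemma stoppedW lam m n x : (m <= n)%N -> stopped lam m x -> stopped lam n x.
Proof.
move=> /subnK <-; elim: (n - m)%N => //= k IH mx.
by rewrite addSn stoppedS IH.
Qed.

Lemma le_stopped lam lam' n x : lam <= lam' ->
  stopped lam' n x -> stopped lam n x.
Proof.
move=> ll; apply: sub_has => u /orP[H|H]; apply/orP; [left|right];
  exact: le_lt_trans ll H.
Qed.

Lemma cexp_set_bit_cylinder k u b x y : (u < k)%N -> cylinder k.-1 x y ->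
  F u.+1 (set_bit u b y) = F u.+1 (set_bit u b x).
Proof.
move=> uk xy; apply: (determined_cexp fN (x := set_bit u b x)) => t tu; rewrite /set_bit.
case: eqP => // /eqP tu'; apply: xy.
by move: tu; rewrite ltnS leq_eqVlt (negbTE tu')/= => tu; lia.
Qed.

(** Predictability: the last bit of each test is overwritten by both of its values, so one
    coordinate fewer is read. Hence [first_stop lam i] has level i. *)
Lemma stopped_cylinder lam n x y : cylinder n.-1 x y ->
  stopped lam n y = stopped lam n x.
Proof.
move=> xy; apply: eq_in_has => u; rewrite mem_iota add0n /= => un.
by rewrite !(cexp_set_bit_cylinder _ un xy).
Qed.

Lemma first_stop_cylinder lam i x y : cylinder i x y ->
  first_stop lam i y = first_stop lam i x.
Proof.
move=> xy; rewrite /first_stop (stopped_cylinder _ (n := i.+1) xy).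
by rewrite (@stopped_cylinder lam i x y)//; apply: cylinder_sub xy; exact: leq_pred.
Qed.

Lemma not_stopped_le lam n x : ~~ stopped lam n.+1 x -> `|F n.+1 x| <= lam.
Proof.
rewrite stoppedS negb_or negb_or -!leNgt => /and3P[_ H0 H1].
by rewrite -(set_bit_id n x); case: (x n).
Qed.

Lemma stopped_value_run lam k x : ~~ stopped lam k x -> stopped_value lam k x = F k x.
Proof.
elim: k => [_|k IH sk]; first by rewrite /stopped_value big_ord0 addr0.
rewrite /stopped_value big_ord_recr/= sk mul1r addrA.
rewrite [X in X + _]IH; first by rewrite addrC subrK.
by apply: contra sk; exact: stoppedW.
Qed.

Lemma stopped_value_le lam k x : `|F 0 x| <= lam -> `|stopped_value lam k x| <= lam.
Proof.
move=> F0; elim: k => [|k IH]; first by rewrite /stopped_value big_ord0 addr0.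
have [sk|sk] := boolP (stopped lam k.+1 x); last first.
  by rewrite stopped_value_run//; exact: not_stopped_le.
by rewrite /stopped_value big_ord_recr/= sk mul0r addr0.
Qed.

Lemma sum_first_stop lam k x :
  \sum_(i < k) (first_stop lam i x)%:R = (stopped lam k x)%:R :> R.
Proof.
elim: k => [|k IH]; first by rewrite big_ord0.
rewrite big_ord_recr/= IH /first_stop.
have := @stoppedW lam k k.+1 x (leqnSn k).
by case: (stopped lam k x) => [->//|_]; rewrite ?andbF ?addr0// add0r andbT.
Qed.

Definition stop_piece lam lam' i x : R :=
  (first_stop lam i x)%:R * (stopped_value lam' N x - stopped_value lam N x).

(** Restricting to points where [lam] stops loses nothing: elsewhere neither threshold stops and
    both stopped values coincide. *)
Lemma sum_stop_piece lam lam' x : lam <= lam' ->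
  \sum_(i < N) stop_piece lam lam' i x =
  stopped_value lam' N x - stopped_value lam N x.
Proof.
move=> ll; rewrite -mulr_suml sum_first_stop.
have [sN|sN] := boolP (stopped lam N x); first by rewrite mul1r.
have sN' : ~~ stopped lam' N x by apply: contra sN; exact: le_stopped.
by rewrite !stopped_value_run// subrr mulr0.
Qed.

(** Expanded in increments, the piece loses those below level i, since neither threshold has stopped
    yet. An increment at n >= i has a coefficient of level n and is killed by the expectation at
    level n. *)
Lemma cexp_stop_piece lam lam' i y : (i <= N)%N -> lam <= lam' ->
  cexp N i (stop_piece lam lam' i) y = 0.
Proof.
move=> iN ll.
pose c n x : R := (first_stop lam i x)%:R *
  ((~~ stopped lam' n.+1 x)%:R - (~~ stopped lam n.+1 x)%:R).
have pE x : stop_piece lam lam' i x = \sum_(n < N) c n x * (F n.+1 x - F n x).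
  rewrite /stop_piece /stopped_value [X in _ * X](_ : _ =
    \sum_(n < N) ((~~ stopped lam' n.+1 x)%:R - (~~ stopped lam n.+1 x)%:R) *
      (F n.+1 x - F n x)); last first.
    rewrite opprD addrACA subrr add0r -sumrB.
    by apply: eq_bigr => n _; rewrite mulrBl.
  by rewrite mulr_sumr; apply: eq_bigr => n _; rewrite mulrA.
rewrite /cexp (eq_avg _ _ _ pE) avg_sum big1// => n _.
have [ni|ni] := ltnP n i.
  rewrite -[RHS](avg_cst i (N - i) 0 y); apply: eq_avg => x; rewrite /c /first_stop.
  have [si|si] := boolP (stopped lam i x); first by rewrite andbF !mul0r.
  have s1 : ~~ stopped lam n.+1 x by apply: contra si; exact: stoppedW.
  have s2 : ~~ stopped lam' n.+1 x by apply: contra s1; exact: le_stopped.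
  by rewrite s1 s2 subrr mulr0 mul0r.
have nN := ltn_ord n.
rewrite (_ : N - i = (n - i) + (N - n))%N; last by lia.
rewrite avg_cat subnKC// -[RHS](avg_cst i (n - i) 0 y); apply: eq_avg => x.
rewrite avg_pull.
  rewrite avgB -/(cexp N n (F n.+1) x) -/(cexp N n (F n) x).
  by rewrite !cexp_cexp// 1?ltnW// subrr mulr0.
move=> u v uv; rewrite /c (first_stop_cylinder _ (x := u))//.
  by rewrite !(@stopped_cylinder _ n.+1 u v).
exact: cylinder_sub uv.
Qed.

Lemma stop_piece_le lam lam' i x : lam <= lam' -> `|F 0 x| <= lam ->
  `|stop_piece lam lam' i x| <= (lam + lam') * (first_stop lam i x)%:R.
Proof.
move=> ll F0; rewrite normrM mulrC [X in _ * X]ger0_norm// ler_wpM2r//.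
rewrite (le_trans (ler_normB _ _))// addrC lerD ?stopped_value_le//.
exact: le_trans ll.
Qed.

(* The stopping cylinder has half its mass on a child above [lam]. *)
Lemma avg_first_stop lam i : (i < N)%N ->
  avg 0 N (fun x => (first_stop lam i x)%:R : R) o <=
  2 * avg 0 N (fun x => (first_stop lam i x)%:R * (lam < `|F i.+1 x|)%R%:R) o.
Proof.
move=> iN; set g := fun x => (first_stop lam i x)%:R * _.
have dS : determined i (fun x => (first_stop lam i x)%:R : R).
  by move=> x y xy; rewrite (first_stop_cylinder lam xy).
have dg : determined i.+1 g.
  move=> x y xy; rewrite /g (determined_cexp fN xy) (@first_stop_cylinder _ i x y)//.
  exact: cylinder_sub xy.
rewrite -(subnKC iN) (avg_widen _ _ dg)// -addn1 -addnA.
rewrite (avg_widen _ _ dS)// avg_cat -avgZ.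
apply: le_avg => x /=; rewrite add0n /g.
have sb b : first_stop lam i (set_bit i b x) = first_stop lam i x.
  apply: first_stop_cylinder => k ki; rewrite /set_bit.
  by rewrite (ltn_eqF ki).
rewrite !sb; case: (boolP (first_stop lam i x)) => [|_]; last first.
  by rewrite !mul0r addr0 mul0r mulr0.
rewrite /first_stop stoppedS andbC; case: (stopped lam i x) => //= /orP[H|H];
  rewrite H !mul1r.
  by case: (_ < _) => /=; lra.
by case: (_ < _) => /=; lra.
Qed.

Lemma sum_avg_first_stop lam :
  \sum_(i < N) avg 0 N (fun x => (first_stop lam i x)%:R : R) o <=
  2 * avg 0 N (fun x => (lam < maxfun N f x)%R%:R) o.
Proof.
apply: (le_trans (ler_sum _ (fun i _ => avg_first_stop lam (ltn_ord i)))).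
rewrite -mulr_sumr ler_pM2l// -avg_sum; apply: le_avg => x.
apply: (@le_trans _ _ (\sum_(i < N) (first_stop lam i x)%:R * (lam < maxfun N f x)%R%:R)).
  apply: ler_sum => i _; rewrite ler_wpM2l// ler_nat.
  case: (ltP lam `|F i.+1 x|) => //= H.
  by rewrite (lt_le_trans H)// cexp_le_maxfun.
by rewrite -mulr_suml sum_first_stop ler_piMl// lern1 leq_b1.
Qed.

Lemma stopped_value_all lam x : (forall y, `|f y| <= lam) ->
  stopped_value lam N x = f x.
Proof.
move=> flam; rewrite stopped_value_run ?cexp_N//.
apply/hasPn => u _; rewrite negb_or -!leNgt.
have H y : `|F u.+1 y| <= lam.
  rewrite (le_trans (normr_avg _ _ _ _))//.
  by rewrite -(avg_cst u.+1 (N - u.+1) lam y); exact: le_avg.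
by rewrite !H.
Qed.

End Stopping.

(** * Geometric level sums and dyadic blocks of logarithmic sums *)

Section LevelSums.
Context {R : realType}.

(** The terms grow geometrically, so the last level below [y] dominates; this replaces the
    layer-cake integral. *)
Lemma level_sum (p lam y : R) J : 0 < p -> 0 < lam -> 0 <= y ->
  \sum_(j < J) (lam * 2 ^+ j) `^ p * (lam * 2 ^+ j < y)%R%:R <=
  2 `^ p / (2 `^ p - 1) * y `^ p.
Proof.
move=> p0 lam0 y0; set q := 2 `^ p.
have q1 : 1 < q := two_powR_gt1 p0.
have q0 : 0 < q - 1 by rewrite subr_gt0.
have C0 : 0 <= q / (q - 1) by rewrite divr_ge0 ?(ltW q0)// ltW// (lt_trans _ q1).
elim: J => [|J IH]; first by rewrite big_ord0 mulr_ge0 ?powR_ge0.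
rewrite big_ord_recr/=; case: (ltP (lam * 2 ^+ J) y) => /= [Jy|_]; last first.
  by rewrite mulr0 addr0.
have lamE j : (lam * 2 ^+ j) `^ p = lam `^ p * q ^+ j.
  by rewrite powRM ?(ltW lam0) ?exprn_ge0// -powR_mulrn// powRAC powR_mulrn ?powR_ge0.
rewrite mulr1 (@le_trans _ _ (\sum_(j < J.+1) lam `^ p * q ^+ j))//.
  rewrite big_ord_recr/= lamE lerD2r; apply: ler_sum => j _; rewrite lamE.
  by rewrite ler_piMr ?mulr_ge0 ?powR_ge0 ?exprn_ge0 ?powR_ge0// lern1 leq_b1.
rewrite -mulr_sumr (le_trans (ler_wpM2l (powR_ge0 _ _) (geom_sum_ge J.+1 q1)))//.
rewrite [leLHS](_ : _ = q / (q - 1) * (lam `^ p * q ^+ J)); last by rewrite exprS; ring.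
rewrite ler_wpM2l// -lamE; apply: ge0_ler_powR; rewrite ?nnegrE ?(ltW p0) ?(ltW Jy)//.
by rewrite mulr_ge0 ?exprn_ge0 ?(ltW lam0).
Qed.

End LevelSums.

Section LogSums.
Context {R : realType}.

(** The block [2^s, 2^(s+1)) has 2^s members, each of weight at most 2^-s. *)
Lemma log_sum (u v : nat -> R) n : (0 < n)%N -> (forall s, 0 <= v s) ->
  (forall m, (0 < m <= n)%N -> u m <= v (trunc_log 2 m)) ->
  \sum_(1 <= m < n.+1) u m * (1 / m%:R) <= \sum_(s < (trunc_log 2 n).+1) v s.
Proof.
move=> n0 v0 uv.
rewrite (@le_trans _ _ (\sum_(1 <= m < n.+1) v (trunc_log 2 m) * (1 / m%:R)))//.
  rewrite big_nat [leRHS]big_nat; apply: ler_sum => m /andP[m0 mn].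
  by rewrite ler_wpM2r ?divr_ge0// uv// m0.
have /andP[_ nlt] := trunc_log_bounds (ltnSn 1) n0.
rewrite (@le_trans _ _ (\sum_(1 <= m < 2 ^ (trunc_log 2 n).+1)
    v (trunc_log 2 m) * (1 / m%:R)))//.
  rewrite (@big_cat_nat _ _ _ n.+1 1 (2 ^ (trunc_log 2 n).+1))//= lerDl.
  by apply: sumr_ge0 => m _; rewrite mulr_ge0 ?divr_ge0.
elim: (trunc_log 2 n).+1 => [|S IH]; first by rewrite big_geq// big_ord0.
have pS : (0 < 2 ^ S)%N by rewrite expn_gt0.
rewrite (@big_cat_nat _ _ _ (2 ^ S))//=; last by rewrite leq_exp2l.
rewrite big_ord_recr/=; apply: lerD => //.
rewrite (@le_trans _ _ (\sum_(2 ^ S <= m < 2 ^ S.+1) v S * (1 / (2 ^ S)%:R)))//.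
  rewrite big_nat [leRHS]big_nat; apply: ler_sum => m mS.
  rewrite (trunc_log_eq _ mS)// ler_wpM2l// !div1r.
  have m0 : (0 < m)%N by apply: leq_trans pS _; case/andP : mS.
  by rewrite lef_pV2 ?posrE ?ltr0n// ler_nat; case/andP : mS.
rewrite sumr_const_nat expnS mul2n -addnn addnK -[leLHS]mulr_natr.
by rewrite -mulrA div1r mulVf ?mulr1// pnatr_eq0 -lt0n.
Qed.

End LogSums.

(** * Logarithmic means of bounded functions, of atoms and of general functions *)

Section LogarithmicMeans.
Context {R : realType}.
Variable a : R.
Hypotheses (a0 : 0 < a) (a1 : a < 1).
Variables N n : nat.
Hypotheses (n0 : (0 < n)%N) (nN : (trunc_log 2 n < N)%N).
Implicit Types (f g h : dyadic_group -> R) (x y t : dyadic_group).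
Local Notation p := (1 / (1 + a)).
Local Notation b := (2 `^ a).
Local Notation o := zero_point.
Local Notation hp := (hp N p).
Local Notation T := (trunc_log 2 n).

Let b1 : 1 < b := two_powR_gt1 a0.
Let b0 : 0 < b := lt_trans ltr01 b1.

Let p0 : 0 < p. Proof. by rewrite divr_gt0// addr_gt0. Qed.
Let p1 : p <= 1.
Proof. by rewrite ler_pdivrMr ?addr_gt0// mul1r lerDl ltW. Qed.

Lemma critical_exponent : (2 * b) `^ p = 2.
Proof.
have a10 : 1 + a != 0 by rewrite gt_eqF// addr_gt0.
rewrite -{1}(@powRr1 R 2)// -powRD; last by rewrite pnatr_eq0 implybT.
by rewrite -powRrM div1r divff// powRr1.
Qed.
Local Notation bp := critical_exponent.

Let s : R := b `^ p.
Let s1 : 1 < s.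
Proof.
by rewrite /s -powRrM two_powR_gt1// mulr_gt0.
Qed.
Let s0 : 0 < s := lt_trans ltr01 s1.
Let r : R := s^-1.
Let r0 : 0 < r. Proof. by rewrite invr_gt0. Qed.
Let r1 : r < 1. Proof. by rewrite invf_lt1. Qed.
Let s2p : s * 2 `^ p = 2.
Proof. by rewrite mulrC -powRM ?(ltW b0)// bp. Qed.

Definition mean m f x : R :=
  (cesaro_num a m)^-1 * dconv N f (cesaro_kernel a m) x.

Let mean_scale m : (0 < m)%N -> (`|(cesaro_num a m)^-1|) `^ p <= r ^+ trunc_log 2 m.
Proof.
move=> m0; have /andP[lm _] := trunc_log_bounds (ltnSn 1) m0.
have Ab : b ^+ trunc_log 2 m <= cesaro_num a m.
  apply: le_trans (cesaro_num_ge a0 a1 m); rewrite -pow2_powR.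
  apply: ge0_ler_powR; rewrite ?nnegrE ?(ltW a0)//.
  by rewrite ler_nat ltnW// ltnS.
have A0 := cesaro_num_gt0 a0 m.
rewrite gtr0_norm ?invr_gt0//.
have -> : (cesaro_num a m)^-1 `^ p = (cesaro_num a m `^ p)^-1.
  by rewrite -(@powR_inv1 _ (cesaro_num a m)) ?(ltW A0)// powRAC powR_inv1 ?powR_ge0.
rewrite exprVn lef_pV2 ?posrE ?powR_gt0 ?exprn_gt0//.
rewrite -(powR_expn p _ (ltW b0)).
by apply: le_powR_p => //; rewrite exprn_ge0 ?(ltW b0).
Qed.

Let in_range m : (0 < m <= n)%N ->
  (m <= 2 ^ (trunc_log 2 m).+1)%N /\ (trunc_log 2 m < N)%N.
Proof.
move=> /andP[m0 mn]; have /andP[_ /ltnW ->] := trunc_log_bounds (ltnSn 1) m0.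
by split=> //; rewrite (leq_ltn_trans _ nN)// leq_trunc_log.
Qed.

Lemma hp_mean m f : (0 < m)%N ->
  hp (mean m f) <= r ^+ trunc_log 2 m * hp (dconv N f (cesaro_kernel a m)).
Proof.
move=> m0; apply: (le_trans (hpZ N p0 _ _)).
by rewrite ler_wpM2r ?hp_ge0// mean_scale.
Qed.

Definition bounded_cst : R := (kernel_L1_cst a * b) `^ p.

Lemma hp_mean_bounded m f (lam : R) : (0 < m <= n)%N -> 0 <= lam ->
  (forall t, `|f t| <= lam) -> hp (mean m f) <= bounded_cst * lam `^ p.
Proof.
move=> mn lam0 flam; have [mi iN] := in_range mn.
have m0 : (0 < m)%N by case/andP : mn.
have kN := determinedW iN (determined_kernel a mi).
have L0 := kernel_L1_cst_ge0 a0 a1.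
apply: (le_trans (hp_mean f m0)).
have B x := maxfun_dconv_bounded kN flam (avg_kernel a0 a1 x mi iN).
have B0 : 0 <= lam * (kernel_L1_cst a * b ^+ (trunc_log 2 m).+1).
  by rewrite !mulr_ge0 ?exprn_ge0 ?(ltW b0).
apply: (le_trans (ler_wpM2l _ (hp_le p0 B0 B))).
  by rewrite exprn_ge0 ?(ltW r0).
set k := trunc_log 2 m; set L := kernel_L1_cst a in L0 *.
have -> : lam * (L * b ^+ k.+1) = L * b * lam * b ^+ k by rewrite exprS; ring.
have Lb : 0 <= L * b by rewrite mulr_ge0 ?(ltW b0).
have bk : 0 <= b ^+ k by rewrite exprn_ge0 ?(ltW b0).
rewrite powRM ?(mulr_ge0 Lb)// powRM// powR_expn ?(ltW b0)// -/s mulrCA -exprMn.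
by rewrite mulVf ?gt_eqF// expr1n mulr1.
Qed.

Lemma hp_mean_atom m M f h (lam : R) : (0 < m <= n)%N -> (M <= N)%N ->
  determined M h -> 0 <= lam -> (forall t, h t = 0 \/ h t = 1) ->
  (forall t, `|f t| <= lam * h t) -> (forall y, cexp N M f y = 0) ->
  hp (mean m f) <= kernel_power_cst a p * (lam `^ p * avg 0 M h o) *
   ((M <= trunc_log 2 m)%:R * (M%:R * s ^+ M * r ^+ trunc_log 2 m + s)).
Proof.
move=> mn MN hM lam0 h01 fh f0; have [mi iN] := in_range mn.
have m0 : (0 < m)%N by case/andP : mn.
have kN := determinedW iN (determined_kernel a mi).
have [Ms|sM] := leqP M (trunc_log 2 m); last first.
  rewrite mul0r mulr0 hp0// => x; rewrite /mean (@dconv_eq0 _ _ M)// ?mulr0//.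
  apply: determined_kernel; rewrite (leq_trans mi)// leq_exp2l//.
rewrite [true%:R * _]mul1r; set k := trunc_log 2 m in mi iN Ms *.
have Hk x := avg_kernel_powR a0 a1 p0 p1 bp (M := M) (c := N - M) x mi (leqW Ms) _.
rewrite subnKC// in Hk.
apply: (le_trans (hp_mean f m0)).
apply: (le_trans (ler_wpM2l _ (hp_dconv_atom p0 p1 MN kN hM lam0 h01 fh f0 (Hk iN)))).
  by rewrite exprn_ge0 ?(ltW r0).
(* At the critical exponent the loss per bit of the power step equals b^p, the growth of the p-th
   power of the normalization per binary digit of m. *)
rewrite -/k (_ : 2 / 2 `^ p = s); last first.
  by apply: (canLR (mulfK _)); rewrite ?s2p// gt_eqF// powR_gt0.
rewrite powRM ?exprn_ge0 ?(ltW b0)// !powR_expn ?(ltW b0)// -/s.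
rewrite le_eqVlt; apply/orP; left; apply/eqP.
rewrite [LHS](_ : _ = kernel_power_cst a p * (lam `^ p * avg 0 M h o) *
  (M%:R * s ^+ M * r ^+ k + (s * 2^-1 * 2 `^ p) ^+ M * (r * s) ^+ k * s)); last first.
  by rewrite !exprMn exprS; ring.
have -> : s * 2^-1 * 2 `^ p = 1 by rewrite mulrAC s2p divff.
by rewrite mulVf ?gt_eqF// !expr1n !mul1r.
Qed.

Definition log_mean f : R := \sum_(1 <= m < n.+1) hp (mean m f) * (1 / m%:R).

Lemma log_meanD f g :
  log_mean (fun x => f x + g x) <= log_mean f + log_mean g.
Proof.
rewrite /log_mean -big_split; apply: ler_sum => m _ /=.
rewrite -mulrDl ler_wpM2r ?divr_ge0//.
rewrite (le_trans _ (hpD N p0 p1 _ _))// /hp.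
rewrite le_eqVlt; apply/orP; left; apply/eqP; apply: eq_avg => x.
congr (_ `^ _); apply: eq_maxfun => y; rewrite /mean /dconv -mulrDr -avgD.
by congr (_ * _); apply: eq_avg => t; rewrite mulrDl.
Qed.

Lemma eq_log_mean f g : f =1 g -> log_mean f = log_mean g.
Proof. by move=> /funext ->. Qed.

Lemma log_mean0 f : (forall x, f x = 0) -> log_mean f = 0.
Proof.
move=> f0; rewrite /log_mean big1// => m _; rewrite hp0 ?mul0r// => x.
rewrite /mean /dconv (@eq_avg _ _ _ _ (fun=> 0)) ?avg_cst ?mulr0// => t.
by rewrite f0 mul0r.
Qed.

Lemma log_mean_sum J (G : nat -> dyadic_group -> R) :
  log_mean (fun x => \sum_(j < J) G j x) <= \sum_(j < J) log_mean (G j).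
Proof.
elim: J => [|J IH].
  by rewrite big_ord0 log_mean0// => x; rewrite big_ord0.
rewrite big_ord_recr/= (@eq_log_mean _ (fun x => \sum_(j < J) G j x + G J x)); last first.
  by move=> x; rewrite big_ord_recr.
by rewrite (le_trans (log_meanD _ _))// lerD2r.
Qed.

Lemma log_mean_bounded f (lam : R) : 0 <= lam ->
  (forall t, `|f t| <= lam) -> log_mean f <= T.+1%:R * (bounded_cst * lam `^ p).
Proof.
move=> lam0 flam.
apply: (le_trans (@log_sum _ (fun m => hp (mean m f)) (fun=> bounded_cst * lam `^ p) n n0 _ _)).
- by move=> _; rewrite mulr_ge0 ?powR_ge0.
- by move=> m mn; exact: hp_mean_bounded.
- by rewrite sumr_const card_ord -[leLHS]mulr_natr mulrC.
Qed.

Definition atom_cst : R := kernel_power_cst a p * ((1 - r)^-1 + s).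

Lemma kernel_power_cst_ge0 : 0 <= kernel_power_cst a p.
Proof.
rewrite /kernel_power_cst addr_ge0 ?powR_ge0// mulr_ge0 ?powR_ge0// mulr_ge0//.
have q1 : 1 < 2 `^ p := two_powR_gt1 p0.
by rewrite divr_ge0 ?invr_ge0 ?powR_ge0// subr_ge0 ltW// invf_lt1// (lt_trans _ q1).
Qed.

Lemma atom_cst_ge0 : 0 <= atom_cst.
Proof.
rewrite mulr_ge0 ?kernel_power_cst_ge0// addr_ge0 ?(ltW s0)//.
by rewrite invr_ge0 subr_ge0 ltW.
Qed.

Lemma log_mean_atom M f h (lam : R) : (M <= N)%N ->
  determined M h -> 0 <= lam -> (forall t, h t = 0 \/ h t = 1) ->
  (forall t, `|f t| <= lam * h t) -> (forall y, cexp N M f y = 0) ->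
  log_mean f <= T.+1%:R * (atom_cst * (lam `^ p * avg 0 M h o)).
Proof.
move=> MN hM lam0 h01 fh f0.
have h0 : 0 <= avg 0 M h o by apply: avg_ge0 => t; case: (h01 t) => ->.
set D := kernel_power_cst a p * (lam `^ p * avg 0 M h o).
have D0 : 0 <= D by rewrite mulr_ge0 ?kernel_power_cst_ge0// mulr_ge0 ?powR_ge0.
have V0 k : 0 <= M%:R * s ^+ M * r ^+ k + s.
  by rewrite addr_ge0 ?(ltW s0)// !mulr_ge0 ?exprn_ge0 ?(ltW s0) ?(ltW r0).
apply: (le_trans (@log_sum _ (fun m => hp (mean m f))
  (fun k => D * ((M <= k)%:R * (M%:R * s ^+ M * r ^+ k + s))) n n0 _ _)).
- by move=> k; rewrite mulr_ge0// mulr_ge0.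
- by move=> m mn; exact: hp_mean_atom.
rewrite -mulr_sumr [leRHS](_ : _ = D * (T.+1%:R * ((1 - r)^-1 + s))); last first.
  by rewrite /D /atom_cst; ring.
rewrite ler_wpM2l// mulrDr.
have [MT|TM] := leqP M T; last first.
  rewrite big1; first by rewrite addr_ge0// mulr_ge0 ?invr_ge0 ?subr_ge0 ?(ltW r1) ?(ltW s0).
  by move=> k _; rewrite leqNgt (leq_trans (ltn_ord k) TM) mul0r.
have E : forall k : 'I_T.+1, true ->
    (M <= k)%:R * (M%:R * s ^+ M * r ^+ k + s) <=
    (if (M <= k)%N then M%:R * s ^+ M * r ^+ k else 0) + s.
  by move=> k _; case: leqP => _; rewrite ?mul1r// mul0r add0r ltW.
apply: (le_trans (ler_sum _ E)).
rewrite big_split/= sumr_const card_ord -[s *+ _]mulr_natl lerD2r.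
rewrite -(big_mkord xpredT (fun k => if (M <= k)%N then M%:R * s ^+ M * r ^+ k else 0)).
rewrite (@big_cat_nat _ _ _ M)//=; last exact: leqW.
rewrite big_nat big1 ?add0r; last first.
  by move=> k /andP[_ kM]; rewrite leqNgt kM.
rewrite big_nat (eq_bigr (fun k => M%:R * s ^+ M * r ^+ k)); last first.
  by move=> k /andP[-> _].
rewrite -big_nat -mulr_sumr.
apply: (le_trans (ler_wpM2l _ (geom_sum_le M T.+1 r0 r1))).
  by rewrite mulr_ge0 ?exprn_ge0 ?(ltW s0).
rewrite -mulrA (mulrA (s ^+ M)) -exprMn mulfV ?gt_eqF// expr1n mul1r.
rewrite ler_wpM2r ?invr_ge0 ?subr_ge0 ?(ltW r1)// ler_nat.
exact: leqW.
Qed.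

(** In the second term, 3 comes from the bound lambda + 2 lambda of a piece, 2 from the half mass of
    a stopping cylinder, and the quotient from [level_sum]. *)
Definition log_mean_cst : R :=
  bounded_cst + atom_cst * 3 `^ p * 2 * (2 `^ p / (2 `^ p - 1)).

Lemma log_mean_cst_ge0 : 0 <= log_mean_cst.
Proof.
have q0 : 0 <= 2 `^ p / (2 `^ p - 1) :> R.
  by rewrite divr_ge0 ?powR_ge0// subr_ge0 ltW// two_powR_gt1.
rewrite addr_ge0 ?powR_ge0// mulr_ge0// mulr_ge0// mulr_ge0 ?powR_ge0//.
exact: atom_cst_ge0.
Qed.

Section Decomposition.
Variable f : dyadic_group -> R.
Hypothesis fN : determined N f.

Lemma determined_bounded : exists B : R, forall y, `|f y| <= B.
Proof.
have gN : determined N (fun y => `|f y|) by move=> u v /fN ->.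
exists (2 ^+ N * avg 0 N (fun y => `|f y|) o) => y.
rewrite (@determined_avg _ N 0 N _ _ gN y o)//.
by apply: (@avg_ge_cylinder _ 0 N (fun y => `|f y|)) => z; exact: normr_ge0.
Qed.

Lemma log_mean_level (lam : R) : 0 < lam -> (forall x, `|cexp N 0 f x| <= lam) ->
  log_mean f <= T.+1%:R * (bounded_cst * lam `^ p +
    atom_cst * 3 `^ p * 2 * (2 `^ p / (2 `^ p - 1)) * hp f).
Proof.
move=> lam0 F0.
pose L j := lam * 2 ^+ j.
have Lpos j : 0 < L j by rewrite mulr_gt0// exprn_gt0.
have LS j : L j <= L j.+1.
  by rewrite ler_pM2l// ler_eXn2l ?ltr1n.
have lamL j : lam <= L j by rewrite ler_peMr ?(ltW lam0)// exprn_ege1// ler1n.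
have F0L j x : `|cexp N 0 f x| <= L j by exact: le_trans (lamL j).
have [B fB] := determined_bounded.
have B0 : 0 <= B by exact: le_trans (fB o).
(* A top level above the supremum of [f] never stops, so its stopped value is [f] and the
   telescoping is finite. *)
have [J BJ] : exists J, B <= L J.
  exists (Num.trunc (B / lam)).+1; rewrite -ler_pdivrMl// mulrC.
  rewrite (le_trans (ltW (truncnS_gt _)))// -natrX ler_nat ltnW//.
  by rewrite (leq_trans (ltn_expl _ (ltnSn 1))).
have fJ y : `|f y| <= L J by exact: le_trans BJ.
pose st j := stopped_value N f (L j) N.
pose pc j i := stop_piece N f (L j) (L j.+1) i.
have fE x : f x = st 0%N x + \sum_(j < J) \sum_(i < N) pc j i x.
  rewrite (eq_bigr (fun j : 'I_J => st j.+1 x - st j x)); last first.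
    by move=> j _; rewrite /pc sum_stop_piece.
  rewrite -(@stopped_value_all _ N f (L J) x fJ) -/(st J x).
  elim: (J) => [|k IH]; first by rewrite big_ord0 addr0.
  by rewrite big_ord_recr/= addrA -IH addrC subrK.
rewrite (eq_log_mean fE) (le_trans (log_meanD _ _))// mulrDr lerD//.
  apply: log_mean_bounded; first exact: ltW.
  move=> t; rewrite -[lam]mulr1 -(expr0 2).
  by apply: stopped_value_le => //; exact: F0L 0%N t.
apply: (le_trans (log_mean_sum J (fun j x => \sum_(i < N) pc j i x))).
have A0 := atom_cst_ge0.
rewrite (@le_trans _ _ (\sum_(j < J) T.+1%:R * (atom_cst * 3 `^ p * 2 *
   (L j `^ p * avg 0 N (fun x => (L j < maxfun N f x)%R%:R) o))))//.
  apply: ler_sum => j _.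
  apply: (le_trans (log_mean_sum N (pc j))).
  rewrite (@le_trans _ _ (\sum_(i < N) T.+1%:R * (atom_cst * ((3 * L j) `^ p *
      avg 0 N (fun x => (first_stop N f (L j) i x)%:R) o))))//.
    apply: ler_sum => i _.
    have hi : determined i (fun x => (first_stop N f (L j) i x)%:R : R).
      by move=> x y xy; rewrite (first_stop_cylinder fN (L j) xy).
    have := @avg_widen _ i 0 i (N - i) _ o hi (leqnn i).
    rewrite subnKC ?(ltnW (ltn_ord i))// => ->.
    apply: log_mean_atom => //.
    - exact: ltnW.
    - by rewrite mulr_ge0 ?(ltW (Lpos j)).
    - by move=> t; case: first_stop; [right|left].
    - move=> t; apply: (le_trans (stop_piece_le i (LS j) (F0L j t))).
      rewrite ler_wpM2r// /L exprS.
      by rewrite le_eqVlt; apply/orP; left; apply/eqP; ring.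
    - by move=> y; apply: cexp_stop_piece => //; exact: ltnW.
  rewrite -!mulr_sumr powRM ?(ltW (Lpos j))// ler_wpM2l//.
  rewrite -[leRHS]mulrA -[leRHS]mulrA ler_wpM2l// -mulrA ler_wpM2l ?powR_ge0//.
  rewrite mulrCA ler_wpM2l ?powR_ge0//.
  exact: (sum_avg_first_stop fN (L j)).
rewrite -mulr_sumr ler_wpM2l// -mulr_sumr -[leRHS]mulrA ler_wpM2l//.
  by rewrite mulr_ge0// mulr_ge0 ?powR_ge0.
rewrite (eq_bigr (fun j : 'I_J => avg 0 N
   (fun x => L j `^ p * (L j < maxfun N f x)%R%:R) o)); last by move=> j _; rewrite avgZ.
rewrite -avg_sum /hp -avgZ; apply: le_avg => x.
by apply: level_sum; rewrite ?maxfun_ge0.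
Qed.

(** The constant value of the expectation at level 0 is dominated by the maximal function, so the
    p-th power of its modulus is at most [hp f]; this allows a lowest level with p-th power
    [hp f + eps]. The [eps] keeps that level positive when [hp f] vanishes. *)
Lemma log_mean_hp : log_mean f <= T.+1%:R * (log_mean_cst * hp f).
Proof.
have T0 : 0 < T.+1%:R :> R by [].
have Bc : 0 <= bounded_cst by exact: powR_ge0.
rewrite -ler_pdivrMl//; apply/ler_addgt0Pr => e e0.
pose eps := e / (bounded_cst + 1).
have eps0 : 0 < eps by rewrite divr_gt0// ltr_wpDl.
have be : bounded_cst * eps <= e.
  by rewrite mulrCA ler_piMr ?(ltW e0)// ler_pdivrMr ?ltr_wpDl// mul1r lerDl.
have hp0' := @hp_ge0 R N p f.
have h0 : 0 < hp f + eps by rewrite ltr_wpDl.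
pose lam := (hp f + eps) `^ (p^-1).
have lamp : lam `^ p = hp f + eps.
  by rewrite -powRrM mulVf ?gt_eqF// powRr1// ltW.
have lam0 : 0 < lam by rewrite powR_gt0.
have F0 x : `|cexp N 0 f x| <= lam.
  rewrite leNgt; apply/negP => H.
  have : lam `^ p <= hp f.
    rewrite -(avg_cst 0 N (lam `^ p) o); apply: le_avg => y.
    apply: le_powR_p => //; first exact: ltW.
    apply: le_trans (cexp_le_maxfun f y (leq0n N)).
    by rewrite (@determined_cexp _ N 0 f fN x y)// ltW.
  by rewrite lamp gerDl leNgt eps0.
rewrite ler_pdivrMl// (le_trans (log_mean_level lam0 F0))// ler_pM2l//.
rewrite lamp /log_mean_cst; move: be; lra.
Qed.

End Decomposition.
End LogarithmicMeans.

(** * From finite averages to Haar integrals and martingales *)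

Section HaarIntegral.
Context {R : realType} (mu : probability dyadic_group R).
Hypothesis haar_mu : is_haar mu.
Implicit Types (f g : dyadic_group -> R) (x y t : dyadic_group).
Local Notation o := zero_point.

Lemma determined_measurable N g : determined N g -> measurable_fun setT g.
Proof.
move=> gN _ B mB; rewrite setTI; apply: (@sigma_cylinders_measurable N).
by apply/sigma_cylindersP => x y /= + xy; rewrite (gN _ _ xy).
Qed.

Lemma determined_integrable N g : determined N g -> integrable_fun mu g.
Proof.
move=> gN; apply: measurable_bounded_integrable => //.
- by rewrite [ltLHS](probability_setT mu) ltry.
- exact: determined_measurable gN.
have [M gM] := determined_bounded gN.
exists M; split; first exact: num_real.
by move=> K MK y _ /=; rewrite (le_trans (gM y) (ltW MK)).
Qed.

Lemma Rintegral_cylinder N k c g x : (N <= k + c)%N -> determined N g ->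
  \int[mu]_(y in cylinder k x) g y = 2^-1 ^+ k * avg k c g x.
Proof.
elim: c k x => [|c IH] k x Nkc gN.
  have gk : determined k g by apply: determinedW gN; rewrite addn0 in Nkc.
  rewrite (@eq_Rintegral _ _ _ mu _ (cst (g x))); last first.
    by move=> y; rewrite inE => /gk.
  rewrite Rintegral_cst; last exact: measurable_cylinder.
  by rewrite [X in fine X](haar_cylinder _ _ haar_mu)/= mulrC.
have mc := @measurable_cylinder k.+1.
rewrite cylinder_split Rintegral_setU//; last 2 first.
- by apply: integrableS (determined_integrable gN) => //; exact: measurableU.
- by apply/disj_set2P; exact: cylinder_flipI.
have flipE : dyadic_flip k x = set_bit k (~~ x k) x.
  by apply/funext => j; rewrite /dyadic_flip /set_bit.
rewrite !IH ?addSnnS// flipE -{1}(set_bit_id k x) /= exprS.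
by case: (x k) => /=; field.
Qed.

Lemma RintegralT N g : determined N g -> \int[mu]_x g x = avg 0 N g o.
Proof.
by move=> gN; rewrite -(cylinder0 o) (@Rintegral_cylinder N 0 N)// expr0 mul1r.
Qed.

Lemma integralT N g : determined N g ->
  (\int[mu]_x (g x)%:E = (avg 0 N g o)%:E)%E.
Proof.
move=> gN; rewrite -(RintegralT gN) /Rintegral fineK//.
by apply: integrable_fin_num => //; exact: determined_integrable gN.
Qed.

Lemma dyadic_expE N g k x : determined N g -> dyadic_exp mu g k x = cexp N k g x.
Proof.
move=> gN; rewrite /dyadic_exp (@Rintegral_cylinder N k (N - k))//; last by lia.
by rewrite [X in fine X](haar_cylinder _ _ haar_mu)/= mulrA mulVf ?mul1r// expf_neq0.
Qed.

Section Martingale.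
Variable F : nat -> dyadic_group -> R.
Hypothesis F_mart : dyadic_martingale mu F.

(** The level set of [F n] through [x] is measurable at level n, hence contains the whole cylinder
    of [x]. *)
Lemma martingale_determined n : determined n (F n).
Proof.
have [_ mF _] := F_mart => x y xy.
have := mF n measurableT [set F n x] (measurable_set1 _).
by rewrite setTI => /sigma_cylindersP/(_ x y erefl xy).
Qed.

Lemma martingale_cexp N n x : (n <= N)%N -> F n x = cexp N n (F N) x.
Proof.
move=> nN; have [_ _ /(_ _ _ nN) [_ _ EF]] := F_mart.
have /EF : <<s cylinders n >> (cylinder n x).
  by apply: sub_sigma_algebra; exists x.
rewrite (@Rintegral_cylinder n n 0)//; last 2 first.
- by rewrite addn0.
- exact: martingale_determined.
rewrite (@Rintegral_cylinder N n (N - n)) ?subnKC//; last exact: martingale_determined.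
by move=> /mulfI; apply; rewrite expf_neq0.
Qed.

Lemma fourier_coef_avg N k : (k < N)%N ->
  fourier_coef mu F k = avg 0 N (fun t => F N t * walsh k t) o.
Proof.
move=> kN; have [_ ->] := fourier_coefE k F_mart.
rewrite -(fourier_coef_stationary F_mart (ltnW kN)) (@RintegralT N)//.
move=> x y xy; rewrite (martingale_determined xy); congr (_ * _).
by apply: determined_walsh xy; rewrite (ltn_trans kN)// ltn_expl.
Qed.

Lemma cesaro_num_tail (a : R) m j : (j < m)%N ->
  \sum_(1 <= k < m.+1) (j < k)%:R * cesaro_num (a - 1) (m - k) =
  cesaro_num a (m - j.+1).
Proof.
move=> jm; rewrite (@big_cat_nat _ _ _ j.+1)//=; last exact: leqW.
rewrite big_nat big1 ?add0r; last first.
  by move=> k /andP[_ kj]; rewrite ltnNge -ltnS kj mul0r.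
rewrite big_nat (eq_bigr (fun k => cesaro_num (a - 1) (m - k))); last first.
  by move=> k /andP[jk _]; rewrite jk mul1r.
rewrite -big_nat big_nat_rev /= -cesaro_num_sum.
rewrite -{1}[j.+1]add0n big_addn (_ : m.+1 - j.+1 = (m - j.+1).+1)%N; last by lia.
by rewrite !big_nat; apply: eq_bigr => k kj; congr cesaro_num; lia.
Qed.

Lemma cesaro_meanE (a : R) N m x : (m <= N)%N ->
  cesaro_mean mu a F m x = mean a N m (F N) x.
Proof.
move=> mN; rewrite /cesaro_mean /mean; congr (_ * _).
rewrite (@eq_big_nat _ _ _ _ _ _ (fun k => \sum_(0 <= j < m)
  (j < k)%:R * cesaro_num (a - 1) (m - k) * (fourier_coef mu F j * walsh j x))); last first.
  move=> k /andP[_ km]; rewrite /walsh_sum mulr_sumr [RHS](@big_cat_nat _ _ _ k)//=.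
  rewrite [X in _ = _ + X]big_nat [X in _ = _ + X]big1 ?addr0; last first.
    by move=> j /andP[kj _]; rewrite ltnNge kj !mul0r.
  rewrite big_nat [RHS]big_nat; apply: eq_bigr => j /andP[_ jk].
  by rewrite jk mul1r.
rewrite exchange_big/= big_mkord /dconv.
rewrite (@eq_avg _ _ _ _ (fun t => \sum_(j < m) (cesaro_num a (m - j.+1) * walsh j x) *
  (F N t * walsh j t))); last first.
  move=> t; rewrite /cesaro_kernel mulr_sumr; apply: eq_bigr => j _.
  by rewrite walsh_dyadic_add; ring.
rewrite avg_sum; apply: eq_bigr => j _; have jm := ltn_ord j.
rewrite avgZ -mulr_suml cesaro_num_tail// (@fourier_coef_avg N)//; first by ring.
exact: leq_trans mN.
Qed.

End Martingale.

Section Norms.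
Variables (N : nat) (p : R).
Hypothesis p0 : 0 < p.

Lemma determined_maxfun_powR g : determined N g ->
  determined N (fun x => maxfun N g x `^ p).
Proof. by move=> gN x y xy; rewrite (determined_maxfun gN xy). Qed.

Lemma maximal_function_ge (G : nat -> dyadic_group -> R) g x :
  (forall k, (k <= N)%N -> G k x = cexp N k g x) ->
  ((maxfun N g x)%:E <= maximal_function G x)%E.
Proof.
move=> Gg.
have ub k : (k <= N)%N -> (`|cexp N k g x|%:E <= maximal_function G x)%E.
  by move=> kN; apply: ereal_sup_ubound; exists k => //; rewrite Gg.
rewrite /maxfun; elim/big_ind : _ => [|u v uM vM|k _].
- by apply: le_trans (ub 0%N (leq0n N)); rewrite lee_fin.
- by rewrite /Num.max; case: ifP.
- by apply: ub; rewrite -ltnS.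
Qed.

Lemma maximal_function_dyadic_exp g x : determined N g ->
  maximal_function (dyadic_exp mu g) x = (maxfun N g x)%:E.
Proof.
move=> gN; apply/eqP; rewrite eq_le; apply/andP; split; last first.
  by apply: maximal_function_ge => k _; exact: dyadic_expE.
apply: ge_ereal_sup => _ [k _ <-]; rewrite lee_fin (dyadic_expE _ _ gN).
have [kN|/ltnW Nk] := leqP k N; first exact: cexp_le_maxfun.
apply: le_trans (cexp_le_maxfun g x (leqnn N)).
by rewrite cexp_N /cexp (eqP Nk).
Qed.

Lemma hardy_norm_dyadic_exp g : determined N g ->
  (hardy_norm mu p (dyadic_exp mu g) `^ p = (hp N p g)%:E)%E.
Proof.
move=> gN; rewrite /hardy_norm powR_Lnorm ?gt_eqF// /hp.
rewrite -(integralT (determined_maxfun_powR gN)); apply: eq_integral => x _.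
by rewrite maximal_function_dyadic_exp//= ger0_norm ?maxfun_ge0.
Qed.

Lemma measurable_maximal_function (F : nat -> dyadic_group -> R) :
  (forall n, measurable_fun setT (F n)) ->
  measurable_fun [set: dyadic_group] (maximal_function F).
Proof.
move=> mF.
have := @measurable_fun_esups _ _ _ setT (fun n x => `|F n x|%:E) _ 0%N.
rewrite (_ : (fun x => _) = maximal_function F); last first.
  apply/funext => x; rewrite /esups /sdrop /maximal_function /=.
  by congr ereal_sup; apply/seteqP; split => _ [k _ <-]; exists k.
apply=> n; apply/measurable_EFinP; exact: measurableT_comp.
Qed.

(** [maxfun N] applied to [F N] is the maximum of the first N + 1 terms of the martingale, hence
    lies below the full supremum. *)
Lemma hardy_norm_ge (F : nat -> dyadic_group -> R) : dyadic_martingale mu F ->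
  ((hp N p (F N))%:E <= hardy_norm mu p F `^ p)%E.
Proof.
move=> mF; have FN := martingale_determined mF (n := N).
rewrite /hardy_norm powR_Lnorm ?gt_eqF// /hp.
rewrite -(integralT (determined_maxfun_powR FN)); apply: ge0_le_integral => //.
- by move=> x _; rewrite lee_fin powR_ge0.
- apply/measurable_EFinP; exact: determined_measurable (determined_maxfun_powR FN).
- apply: (measurableT_comp (measurable_poweR p)).
  apply: measurableT_comp; first exact: abse_measurable.
  apply: measurable_maximal_function => n.
  exact: determined_measurable (martingale_determined mF (n := n)).
move=> x _; rewrite -poweR_EFin.
have Mx : ((maxfun N (F N) x)%:E <= maximal_function F x)%E.
  by apply: maximal_function_ge => k kN; exact: martingale_cexp.
have M0 : (0 <= maximal_function F x)%E.
  by apply: le_trans Mx; rewrite lee_fin maxfun_ge0.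
rewrite gee0_abs//; apply: gt0_ler_poweR => //; first exact: ltW.
- by rewrite in_itv/= leey andbT lee_fin maxfun_ge0.
- by rewrite in_itv/= leey andbT.
Qed.

End Norms.
End HaarIntegral.

Theorem theorem2 (R : realType) (mu : probability dyadic_group R)
    (haar_mu : is_haar mu)
    (alpha : R) (alpha_gt0 : 0 < alpha) (alpha_lt1 : alpha < 1) :
  let p := 1 / (1 + alpha) in
  exists c : R, forall F : nat -> dyadic_group -> R, hardy_space mu p F ->
  forall n : nat, (2 <= n)%N ->
  ((1 / ln n%:R)%:E *
   (\sum_(1 <= m < n.+1)
      hardy_norm mu p (dyadic_exp mu (cesaro_mean mu alpha F m)) `^ p *
      (1 / m%:R)%:E)
   <= c%:E * hardy_norm mu p F `^ p)%E.
Proof.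
move=> p; have p0 : 0 < p by rewrite divr_gt0// addr_gt0.
have ln2 : 0 < ln 2 :> R by rewrite ln_gt0// ltr1n.
(* With T the binary logarithm of n, n >= 2 gives T >= 1, so T + 1 <= 2 T, and T ln 2 <= ln n; hence
   the factor 2 / ln 2. *)
exists (2 / ln 2 * log_mean_cst alpha) => F [mF _] n n2.
have n0 : (0 < n)%N by exact: ltnW.
set T := trunc_log 2 n; set L := hardy_norm mu p F.
have [Tn Tlt] := andP (trunc_log_bounds (ltnSn 1) n0).
have TN : (T < n)%N by rewrite (leq_trans _ Tn)// ltn_expl.
have T1 : (0 < T)%N by rewrite trunc_log_gt0.
have C0 : 0 <= log_mean_cst alpha by exact: log_mean_cst_ge0.
have lnT : T%:R * ln 2 <= ln n%:R :> R.
  rewrite -ln_powR ler_ln ?posrE ?powR_gt0 ?ltr0n//.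
  by rewrite powR_mulrn// -natrX ler_nat.
have lnn : 0 < ln n%:R :> R.
  by apply: lt_le_trans lnT; rewrite mulr_gt0// ltr0n.
have FN := martingale_determined mF (n := n).
(* The finite level is n itself: it exceeds T, and [F n] determines all means of order m <= n. *)
rewrite (_ : \sum_(1 <= m < n.+1) _ = (log_mean alpha n n (F n))%:E)%E; last first.
  rewrite /log_mean -sumEFin !big_nat; apply: eq_bigr => m /andP[m1 mn].
  rewrite (_ : cesaro_mean mu alpha F m = mean alpha n m (F n)); last first.
    by apply/funext => x; exact: cesaro_meanE.
  rewrite (@hardy_norm_dyadic_exp _ _ _ n)// => x y xy.
  rewrite /mean /dconv; congr (_ * _); apply: eq_avg => t; congr (_ * _).
  rewrite dyadic_addC [in RHS]dyadic_addC.
  apply: (@determined_translate _ n) => //.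
  by apply: determined_kernel; rewrite ltnW// (leq_ltn_trans _ (ltn_expl n _)).
have H := log_mean_hp alpha_gt0 alpha_lt1 n0 TN FN.
apply: (@le_trans _ _ ((2 / ln 2 * log_mean_cst alpha)%:E * (hp n p (F n))%:E)%E); last first.
  apply: lee_wpmul2l; last exact: hardy_norm_ge.
  by rewrite lee_fin mulr_ge0// divr_ge0// ltW.
rewrite -EFinM -EFinM lee_fin div1r ler_pdivrMl// (le_trans H)//.
rewrite [leRHS](_ : _ = (ln n%:R * 2 / ln 2) * (log_mean_cst alpha * hp n p (F n))).
  rewrite ler_wpM2r ?mulr_ge0 ?hp_ge0// ler_pdivlMr// mulrC.
  have T2 : T.+1%:R <= 2 * T%:R :> R by rewrite -natrM ler_nat; lia.
  apply: le_trans (ler_wpM2l (ltW ln2) T2) _.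
  by rewrite mulrCA mulrC ler_pM2r// mulrC.
by ring.
Qed.
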